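(* Let $D=\bigcup_{m=1}^{M}D_m\subset\mathbb{R}^3$ be a finite union of bounded domains with pairwise disjoint closures, let $k_{max}>0$, and let $g\in C(0,k_{max})$ be a given function with $g(k)\neq 0$ for all $k$ in an interval $I=(a,b)\subset(0,k_{max})$. Let $f\in L^2(\mathbb{R}^3)$ vanish outside $D$, and let the source be $F(y,k)=f(y)g(k)$. For $k\in(0,k_{max})$ let $$u(x,k)=\int_D \frac{e^{ik|x-y|}}{4\pi|x-y|}F(y,k)\,dy,\qquad x\in\mathbb{R}^3,$$ be the radiated field. Fix a point $x\in\mathbb{R}^3\setminus\overline{D}$. Assume that the set $$\{r\in(0,\infty)\,:\, S_r(x)\subset A_D(x),\ \widetilde{f}(r)=0\}$$ has Lebesgue measure zero. Then the annulus $A_D(x)$ is uniquely determined by the data $u(x,k)$, $k\in I$ (at the single point $x$); that is, if $D'$, $f'$ is a second pair satisfying the same hypotheses (with the same $g$ and the same point $x\in\mathbb{R}^3\setminus(\overline{D}\cup\overline{D'})$) and the corresponding fields satisfy $u(x,k)=u'(x,k)$ for all $k\in I$, then $A_D(x)=A_{D'}(x)$.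
   Context: $S_r(x)$ denotes the sphere of radius $r$ centered at $x$. The $x$-annular hull of a bounded domain $D$ is $A_D(x):=\{y\in\mathbb{R}^3:\ \inf_{z\in D}|x-z|\le|x-y|\le\sup_{z\in D}|x-z|\}$. The function $\widetilde f$ is defined by $\widetilde f(r)=\frac{1}{4\pi r}\int_{S_r(x)}f(y)\,ds(y)$ for $r>0$ and $\widetilde f(r)=0$ for $r\le 0$. *)

(* Defs.v *)
From mathcomp Require Import all_boot all_order all_algebra.
From mathcomp Require Import all_classical all_reals all_analysis.
From mathcomp Require Import complex.
Set Implicit Arguments. Unset Strict Implicit. Unset Printing Implicit Defensive.
Import Order.TTheory GRing.Theory Num.Theory.
Import numFieldNormedType.Exports.
Local Open Scope classical_set_scope.
Local Open Scope ring_scope.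

Notation pt3 R := ((R * R) * R)%type.

Definition mkpt3 (R : realType) (a b c : R) : pt3 R := ((a, b), c).

Definition dist3 (R : realType) (x y : pt3 R) : R :=
  Num.sqrt ((x.1.1 - y.1.1) ^+ 2 + (x.1.2 - y.1.2) ^+ 2 + (x.2 - y.2) ^+ 2).

Definition leb3 (R : realType) :=
  ((@lebesgue_measure R \x @lebesgue_measure R) \x @lebesgue_measure R)%E.

Arguments leb3 R : clear implicits.

(* R^3 as a measurable space (product Borel sigma-algebra, the domain of leb3). *)
Definition M3 (R : realType) :=
  ((measurableTypeR R * measurableTypeR R) * measurableTypeR R)%type.

Definition leb2 (R : realType) :=
  (@lebesgue_measure R \x @lebesgue_measure R)%E.

Arguments leb2 R : clear implicits.

Definition cintegral (d : measure_display) (T : measurableType d) (R : realType)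
  (mu : measure T R) (A : set T) (h : T -> R[i]) : R[i] :=
  Complex (Rintegral mu A (fun t => complex.Re (h t))) (Rintegral mu A (fun t => complex.Im (h t))).

Definition rc (R : realType) (r : R) : R[i] := Complex r 0.

Definition bounded3 (R : realType) (A : set (pt3 R)) : Prop :=
  exists M : R, forall y, A y -> dist3 (mkpt3 0 0 0) y <= M.

Definition bounded_domain3 (R : realType) (A : set (pt3 R)) : Prop :=
  A !=set0 /\ @open (pt3 R) A /\ @connected (pt3 R) A /\ bounded3 A.

Definition admissible_D (R : realType) (D : set (pt3 R)) : Prop :=
  exists (M : nat) (Dm : 'I_M -> set (pt3 R)),
    (0 < M)%N /\
    (forall m, bounded_domain3 (Dm m)) /\
    (forall m m', m != m' -> @closure (pt3 R) (Dm m) `&` @closure (pt3 R) (Dm m') = set0) /\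
    D = \bigcup_(m in [set: 'I_M]) Dm m.

Definition L2_supported_in (R : realType) (D : set (pt3 R)) (f : pt3 R -> R[i]) : Prop :=
  @measurable_fun _ _ (M3 R) R [set: M3 R] (fun y => complex.Re (f y)) /\
  @measurable_fun _ _ (M3 R) R [set: M3 R] (fun y => complex.Im (f y)) /\
  (\int[leb3 R]_(y in [set: pt3 R]) ((complex.Re (f y)) ^+ 2 + (complex.Im (f y)) ^+ 2)%:E < +oo)%E /\
  (forall y, ~ D y -> f y = 0).

Definition Phi (R : realType) (x y : pt3 R) (k : R) : R[i] :=
  Complex (cos (k * dist3 x y)) (sin (k * dist3 x y)) * rc (4 * pi * dist3 x y)^-1.

Definition radiated_field (R : realType) (D : set (pt3 R)) (f : pt3 R -> R[i]) (g : R -> R[i])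
  (x : pt3 R) (k : R) : R[i] :=
  cintegral (leb3 R) D (fun y => Phi x y k * (f y * g k)).

(* Surface integral over the sphere S_r(x), written in spherical coordinates:
   r^2 \int_0^pi \int_0^{2pi} h(x + r w(th,ph)) sin th dph dth. *)
Definition sphere_integral (R : realType) (h : pt3 R -> R[i]) (x : pt3 R) (r : R) : R[i] :=
  rc (r ^+ 2) *
  cintegral (leb2 R) [set p : R * R | 0 <= p.1 <= pi /\ 0 <= p.2 <= 2 * pi]
    (fun p => h (mkpt3 (x.1.1 + r * sin p.1 * cos p.2)
                       (x.1.2 + r * sin p.1 * sin p.2)
                       (x.2 + r * cos p.1)) * rc (sin p.1)).

Definition ftilde (R : realType) (f : pt3 R -> R[i]) (x : pt3 R) (r : R) : R[i] :=
  if 0 < r then rc (4 * pi * r)^-1 * sphere_integral f x r else 0.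

Definition sphere3 (R : realType) (x : pt3 R) (r : R) : set (pt3 R) :=
  [set y | dist3 x y = r].

Definition annular_hull (R : realType) (D : set (pt3 R)) (x : pt3 R) : set (pt3 R) :=
  [set y | inf ((fun z => dist3 x z) @` D) <= dist3 x y <= sup ((fun z => dist3 x z) @` D)].

Definition zero_radii (R : realType) (D : set (pt3 R)) (f : pt3 R -> R[i]) (x : pt3 R)
  : set R :=
  [set r | 0 < r /\ sphere3 x r `<=` annular_hull D x /\ ftilde f x r = 0].

(* Main.v *)
From HB Require Import structures.
Require Import Defs.
From mathcomp Require Import all_boot all_order all_algebra.
From mathcomp Require Import all_classical all_reals all_analysis.
From mathcomp Require Import measurable_realfun complex.
From mathcomp Require Import ring lra.
Import Order.TTheory GRing.Theory Num.Theory.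
Import numFieldNormedType.Exports.
Local Open Scope classical_set_scope.
Local Open Scope ring_scope.
Set Implicit Arguments. Unset Strict Implicit. Unset Printing Implicit Defensive.
(** Spherical coordinates centred at [x] turn the field into a one-dimensional
    Fourier transform, [u(x,k) = g(k) * \int_0^oo e^{ikr} ftilde(r) dr].  The
    density [ftilde] is integrable with compact support, so equality of two such
    transforms on an interval of frequencies can be differentiated under the
    integral sign at one frequency [k]: all moments of the difference, modulated
    by [e^{ikr}], vanish, hence [ftilde = ftilde'] almost everywhere.  As [ftilde]
    vanishes off [[inf, sup]] of the distances from [x] to [D] and, by hypothesis,
    is almost everywhere nonzero on it, the two intervals of distances coincide. *)

(** * Change of variables on the line *)

(** Bounded support of the density takes its place: it lets one differentiate in [k] arbitrarily
    often, and it confines the approximation of indicators by polynomials to a compact interval. The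
    position of [x] off the closure of [D] makes the factor [1 / (4 pi |x - y|)] bounded on [D]; as
    an L^2 function of bounded support is integrable, the density is integrable too. Spherical
    coordinates are assembled from one-variable substitutions and Tonelli for nonnegative functions;
    positive and negative parts then carry them to integrable ones. Complex densities are handled as
    pairs of real functions, so that multiplication by [i] becomes a swap with a sign.
    Almost-everywhere information only sees intervals of positive length: openness of [D] guarantees
    that the distances from [x] fill more than one radius. *)

Section change_of_variables.
Context {R : realType}.
Local Notation mu := (@lebesgue_measure R).
Local Open Scope ereal_scope.

Lemma integral_mrestr d (T : measurableType d) (m : {measure set T -> \bar R})
    (E : set T) (mE : measurable E) (F : T -> \bar R) :
  measurable_fun [set: T] F -> (forall t, 0 <= F t) ->
  \int[mrestr m mE]_t F t = \int[m]_(t in E) F t.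
Proof.
move=> mF F0.
rewrite -(setUv E) ge0_integral_setU//; last 3 first.
- exact: measurableC.
- by rewrite setUv.
- by apply/disj_setPS => t [].
rewrite [X in _ + X](_ : _ = 0) ?adde0; last first.
  apply: null_set_integral => //; first exact: measurableC.
  - exact: measurable_funTS.
  - by rewrite /= /mrestr setICl measure0.
apply: eq_measure_integral => A mA AE.
by rewrite /= /mrestr (setIidl AE).
Qed.

(** Both boundary types stay free because a decreasing affine map pulls []u, v]] back to an interval
    closed on the left and open on the right. *)
Lemma integral_indic_itv (x y : bool) (c d : R) : (c <= d)%R ->
  \int[mu]_t (\1_([set` Interval (BSide x c) (BSide y d)]) t)%:E = (d - c)%:E.
Proof.
move=> cd; rewrite integral_indic// setIT.
transitivity (if (c < d)%R then d%:E - c%:E else 0).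
  by rewrite [LHS]lebesgue_measure_itv /= lte_fin.
by move: cd; rewrite le_eqVlt => /orP[/eqP->|->//]; rewrite ltxx subrr.
Qed.

(* The measure [w(t) dt] is realised as the planar measure of the region under the
   graph of [w]; its image under [gam] agrees with Lebesgue measure on intervals. *)
Lemma ge0_change_of_variables (w gam : R -> R) (F : R -> \bar R) :
  measurable_fun setT w -> measurable_fun setT gam -> (forall t, (0 <= w t)%R) ->
  (forall c d, (c < d)%R ->
    \int[mu]_t (w t * \1_(`]c, d]) (gam t))%:E = (d - c)%:E) ->
  measurable_fun setT F -> (forall t, 0 <= F t) ->
  \int[mu]_t F t = \int[mu]_t ((w t)%:E * F (gam t)).
Proof.
move=> mw mgam w0 Hcd mF F0.
pose E := [set p : measurableTypeR R * measurableTypeR R | (0 < p.2 <= w p.1)%R].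
have mE : measurable E.
  rewrite (_ : E = [set p | (0 < p.2)%R] `&` [set p | (p.2 <= w p.1)%R]); last first.
    by apply/seteqP; split => p /=; [move/andP|move=> ?; apply/andP].
  apply: measurableI.
  - rewrite -[X in measurable X]setTI.
    rewrite (_ : [set p | _] = snd @^-1` `]0%R, +oo[%classic); last first.
      by apply/seteqP; split=> p /=; rewrite in_itv/= andbT.
    exact: measurable_snd.
  - rewrite -[X in measurable X]setTI; apply: measurable_fun_le => //.
    exact: (measurableT_comp mw measurable_fst).
pose phi : measurableTypeR R * measurableTypeR R -> measurableTypeR R := gam \o fst.
have mphi : measurable_fun setT phi.
  exact: (measurableT_comp mgam measurable_fst).
pose nu := pushforward (mrestr (mu \x mu) mE) phi.
(* Tonelli on the region [E]: its vertical slice over [t] is []0, w t]], of length [w t]. *)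
have key (G : R -> \bar R) : measurable_fun setT G -> (forall t, 0 <= G t) ->
    \int[(mu \x mu)%E]_(p in E) G (phi p) = \int[mu]_t ((w t)%:E * G (gam t)).
  move=> mG G0.
  rewrite integral_mkcond epatch_indic fubini_tonelli1//=; last 2 first.
  - apply: emeasurable_funM.
      by apply: measurableT_comp.
    by apply/measurable_EFinP; exact: measurable_indic.
  - by move=> p; rewrite mule_ge0// lee_fin.
  apply: eq_integral => t _; rewrite /fubini_F/=.
  transitivity (\int[mu]_s (G (gam t) * (\1_E (t, s))%:E)) => //.
  rewrite ge0_integralZl//; last first.
    apply/measurable_EFinP; apply: (measurableT_comp (measurable_indic mE)) => //.
  rewrite muleC; congr (_ * _).
  transitivity (\int[mu]_s (\1_(`]0%R, w t]) s)%:E).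
    apply: eq_integral => s _; rewrite !indicE.
    have -> // : ((t, s) \in E) = (s \in `]0%R, w t]%classic).
    by apply/idP/idP => /set_mem h; apply/mem_set; move: h; rewrite /E/= in_itv.
  by rewrite integral_indic_itv// subr0.
have nuE A : measurable A -> mu A = nu A.
  apply: lebesgue_measure_unique => X [[c d]] _ <-.
  rewrite /nu /= /pushforward/= /mrestr.
  rewrite -(integral_indic _ mE) ?setTI//; last first.
    by rewrite -[X in measurable X]setTI; apply: mphi.
  rewrite (_ : \int[_]_(p in E) _ = \int[(mu \x mu)%E]_(p in E) ((\1_(`]c, d]) (phi p))%:E))//.
  rewrite (key (fun t => (\1_(`]c, d]) t)%:E)); last 2 first.
  - by apply/measurable_EFinP; exact: measurable_indic.
  - by move=> t; rewrite lee_fin.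
  have [cd|dc] := ltP c d.
    under [RHS]eq_integral do rewrite -EFinM.
    by rewrite Hcd// lebesgue_measure_itv/= lte_fin cd.
  rewrite set_itv_ge ?bnd_simp -?leNgt// measure0.
  by rewrite integral0_eq// => t _; rewrite indic0 mule0.
transitivity (\int[nu]_t F t).
  by apply: eq_measure_integral => A mA _; exact: nuE.
rewrite ge0_integral_pushforward//= preimage_setT.
by rewrite integral_mrestr//; [exact: key | exact: measurableT_comp].
Qed.

(** The preimage of []u, v]] is an interval of length [(v - u) / |l|], and the weight [|l|] restores
    [v - u], which is what the general substitution asks for. *)
Lemma ge0_affine_substitution (l c : R) (F : R -> \bar R) : l != 0%R ->
  measurable_fun setT F -> (forall t, 0 <= F t) ->
  \int[mu]_t F t = \int[mu]_t (`|l|%:E * F (l * t + c)%R).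
Proof.
move=> l0 mF F0.
have mg : measurable_fun setT (fun t : R => l * t + c)%R.
  by apply: measurable_funD => //; exact: measurable_funM.
apply: (@ge0_change_of_variables (fun=> `|l|%R) (fun t => l * t + c)%R) => //.
move=> u v uv.
under eq_integral do rewrite EFinM.
rewrite ge0_integralZl//; last first.
  by apply/measurable_EFinP; apply: measurableT_comp mg => //; exact: measurable_indic.
pose A : set R := (fun t => l * t + c)%R @^-1` `]u, v]%classic.
have -> : \int[mu]_t (\1_(`]u, v]) (l * t + c)%R)%:E = \int[mu]_t (\1_A t)%:E by [].
have [lp|ln] := ltP 0%R l.
  rewrite (_ : A = `]((u - c) / l)%R, ((v - c) / l)%R]%classic); last first.
    apply/seteqP; split => t; rewrite /A /= !in_itv/= ltr_pdivrMr// ler_pdivlMr//;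
      by rewrite ltrBlDr lerBrDr (mulrC t).
  rewrite integral_indic_itv; last by rewrite ler_pM2r ?invr_gt0// lerD2r ltW.
  by rewrite gtr0_norm// -EFinM; congr EFin; field.
have {}ln : (l < 0)%R by rewrite lt_neqAle l0.
rewrite (_ : A = `[((v - c) / l)%R, ((u - c) / l)%R[%classic); last first.
  apply/seteqP; split => t; rewrite /A /= !in_itv/= andbC ltr_ndivlMr// ler_ndivrMr//;
    by rewrite ltrBlDr lerBrDr (mulrC t).
rewrite integral_indic_itv; last by rewrite ler_nM2r ?invr_lt0// lerD2r ltW.
by rewrite ltr0_norm// -EFinM; congr EFin; field.
Qed.

Lemma measurable_invr : measurable_fun setT (fun t : R => t^-1%R).
Proof.
rewrite (_ : setT = [set~ 0%R] `|` [set 0%R]); last by rewrite setUC setUv.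
apply/measurable_funU => //; first exact: measurableC.
split; last exact: measurable_fun_set1.
apply: open_continuous_measurable_fun; first exact/closed_openC/closed_eq.
by move=> t; rewrite inE/= => /eqP t0; exact: inv_continuous.
Qed.

(** The weight is the derivative of [tan] on its principal branch. The condition on intervals
    becomes the fundamental theorem of calculus for [tan] between [atan c] and [atan d]. *)
Lemma ge0_tan_substitution (F : R -> \bar R) :
  measurable_fun setT F -> (forall t, 0 <= F t) ->
  \int[mu]_t F t =
  \int[mu]_t ((\1_(`](- (pi / 2))%R, (pi / 2)%R[) t * ((cos t) ^- 2))%:E * F (tan t)).
Proof.
move=> mF F0.
have mcos : measurable_fun [set: R] (@cos R).
  by apply: continuous_measurable_fun => t; exact: continuous_cos.
have msin : measurable_fun [set: R] (@sin R).
  by apply: continuous_measurable_fun => t; exact: continuous_sin.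
apply: (@ge0_change_of_variables
  (fun t => \1_(`](- (pi / 2))%R, (pi / 2)%R[) t * ((cos t) ^- 2))%R tan) => //.
- apply: measurable_funM; first exact: measurable_indic.
  apply: (measurableT_comp measurable_invr) => //.
  exact: measurable_funX.
- by apply: measurable_funM => //; apply: (measurableT_comp measurable_invr).
- by move=> t; rewrite mulr_ge0// invr_ge0 sqr_ge0.
move=> c d cd.
have acd : (atan c < atan d)%R by exact: lt_atan.
have cosn0 t : t \in `[atan c, atan d] -> (cos t != 0)%R.
  rewrite in_itv/= => /andP[ct td]; rewrite gt_eqF// cos_gt0_pihalf//.
  by rewrite (lt_le_trans (atan_gtNpi2 _) ct) (le_lt_trans td (atan_ltpi2 _)).
(* On the principal branch [tan] is increasing with inverse [atan], so [c < tan t <= d] means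
   [atan c < t <= atan d]. *)
have -> : \int[mu]_t (\1_(`](- (pi / 2))%R, (pi / 2)%R[) t * (cos t) ^- 2 *
    \1_(`]c, d]) (tan t))%:E = \int[mu]_(t in `]atan c, atan d]) ((cos t) ^- 2)%:E.
  rewrite [RHS]integral_mkcond; apply: eq_integral => t _.
  rewrite epatch_indic -EFinM; congr EFin.
  rewrite !indicE !mem_setE mulrAC -natrM mulnb mulrC; congr (_ * (nat_of_bool _)%:R)%R.
  rewrite !in_itv/=; apply/idP/idP.
    move=> /andP[/andP[t1 t2] /andP[t3 t4]].
    have tK : atan (tan t) = t by apply: tanK; rewrite in_itv/= t1.
    by rewrite -tK lt_atan//= le_atan.
  move=> /andP[t1 t2].
  rewrite (lt_trans (atan_gtNpi2 _) t1) (le_lt_trans t2 (atan_ltpi2 _))/=.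
  have ti : t \in `](- (pi / 2))%R, (pi / 2)%R[.
    by rewrite in_itv/= (lt_trans (atan_gtNpi2 _) t1) (le_lt_trans t2 (atan_ltpi2 _)).
  apply/andP; split.
    by rewrite -(atanK c) ltr_tan// in_itv/= atan_gtNpi2 atan_ltpi2.
  rewrite leNgt; apply/negP => dt.
  by have := lt_atan dt; rewrite tanK// ltNge t2.
rewrite integral_itv_obnd_cbnd; last first.
  apply/measurable_EFinP; apply: measurable_funTS.
  by apply: (measurableT_comp measurable_invr); exact: measurable_funX.
rewrite (@continuous_FTC2 _ (fun t => (cos t) ^- 2)%R tan) ?atanK//.
- apply: continuous_in_subspaceT => t; rewrite inE/= => /cosn0 ct.
  apply: (@continuousV _ _ (fun t => cos t ^+ 2)%R); first by rewrite expf_neq0.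
  apply: (@continuous_comp _ _ _ (@cos R) (fun y => y ^+ 2)%R).
    exact: continuous_cos.
  exact: exprn_continuous.
- split.
  + move=> t /subset_itv_oo_cc /cosn0 ct; exact: derivable_tan.
  + apply: cvg_at_right_filter; apply: continuous_tan.
    by apply: cosn0; rewrite in_itv/= lexx ltW.
  + apply: cvg_at_left_filter; apply: continuous_tan.
    by apply: cosn0; rewrite in_itv/= lexx ltW.
- move=> t /subset_itv_oo_cc /cosn0 ct.
  by rewrite derive1E; have [_ ->] := is_derive_tan ct.
Qed.

End change_of_variables.

(** * Polar and spherical coordinates *)

Section leb2_sigma_finite.
Context {R : realType}.
Local Notation mu := (@lebesgue_measure R).
Local Open Scope ereal_scope.

(* The library's canonical sigma-finite structure on a product measure is keyed to
   subprobabilities, hence these instances on the constant [leb2]. *)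
HB.instance Definition _ := Measure.copy (leb2 R) (product_measure1 mu mu).

Lemma sigma_finite_leb2 : sigma_finite setT (leb2 R).
Proof.
have /sigma_finiteP[F [TF ndF Foo]] := sigma_finiteT mu.
exists (fun n => F n `*` F n).
  rewrite -setXTT TF predeqE => -[x y]; split.
    move=> [/= [n _ Fnx] [k _ Gky]]; exists (maxn n k) => //; split.
    - by move: x Fnx; exact/subsetPset/ndF/leq_maxl.
    - by move: y Gky; exact/subsetPset/ndF/leq_maxr.
  by move=> [n _ []/= ? ?]; split; exists n.
move=> k; have [mF Fk] := Foo k; split; first exact: measurableX.
by rewrite [ltLHS]product_measure1E// lte_mul_pinfty// ge0_fin_numE.
Qed.

HB.instance Definition _ := Measure_isSigmaFinite.Build _ _ _ (leb2 R) sigma_finite_leb2.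

End leb2_sigma_finite.

Section polar_coordinates.
Context {R : realType}.
Local Notation mu := (@lebesgue_measure R).
Local Notation pos := (\1_(`]0%R, +oo[%classic) : R -> R).
Local Open Scope ereal_scope.

Lemma posT (r : R) : (0 < r)%R -> pos r = 1%R.
Proof. by move=> r0; rewrite indicE mem_set//= in_itv/= andbT. Qed.

Lemma posF (r : R) : (r <= 0)%R -> pos r = 0%R.
Proof. by move=> r0; rewrite indicE memNset//= in_itv/= andbT; apply/negP; rewrite -leNgt. Qed.

Lemma indic_itvE (i : interval R) (t : R) : \1_([set` i]) t = (t \in i)%:R :> R.
Proof. by rewrite indicE mem_setE. Qed.

Lemma measurable_pos : measurable_fun setT pos.
Proof. exact: measurable_indic. Qed.

Lemma measurable_cos : measurable_fun setT (@cos R).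
Proof. by apply: continuous_measurable_fun => t; exact: continuous_cos. Qed.

Lemma measurable_sin : measurable_fun setT (@sin R).
Proof. by apply: continuous_measurable_fun => t; exact: continuous_sin. Qed.

Lemma measurable_tan : measurable_fun setT (@tan R).
Proof.
apply: measurable_funM; first exact: measurable_sin.
exact: (measurableT_comp measurable_invr measurable_cos).
Qed.

(** Serves to glue pieces cut along open intervals: the cut points form a finite, hence null,
    set. *)
Lemma ge0_integral_eq_off (s : seq R) (F G : R -> \bar R) :
  measurable_fun setT F -> measurable_fun setT G ->
  (forall t, 0 <= F t) -> (forall t, 0 <= G t) ->
  (forall t, t \notin s -> F t = G t) ->
  \int[mu]_t F t = \int[mu]_t G t.
Proof.
move=> mF mG F0 G0 FG; apply: ge0_ae_eq_integral => //.
have s0 : mu [set` s] = 0.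
  by apply: countable_lebesgue_measure0; exact/finite_set_countable/finite_seq.
exists [set` s]; split => //.
  by apply: countable_measurable; [exact: measurable_set1|exact/finite_set_countable/finite_seq].
move=> t /= H; apply: contrapT => /negP ts; apply: H => _; exact: FG.
Qed.

(* The substitutions [a = b t], [t = cot th], [b = r sin th] map the half-plane
   [b > 0] to [r > 0], [0 < th < pi]. The same lemma serves for the azimuth, one
   half-plane at a time, and for the polar angle. *)
Lemma half_polar_coordinates (F : R * R -> \bar R) :
  measurable_fun setT F -> (forall p, 0 <= F p) ->
  \int[mu]_b ((pos b)%:E * \int[mu]_a F (a, b)) =
  \int[mu]_r \int[mu]_th ((pos r * r * \1_(`]0%R, pi[) th)%:E *
                           F (r * cos th, r * sin th)%R).
Proof.
move=> mF F0.
have pos0 (r : R) : (0 <= pos r * r)%R.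
  by have [r0|r0] := ltP 0%R r; [rewrite posT// mul1r ltW|rewrite posF// mul0r].
pose G (p : R * R) : \bar R := (pos p.1 * p.1)%:E * F (p.1 * p.2, p.1)%R.
have mG : measurable_fun setT G.
  apply: emeasurable_funM.
    apply/measurable_EFinP; apply: measurable_funM => //.
    exact: (measurableT_comp measurable_pos).
  apply: (measurableT_comp mF); apply: measurable_fun_pair => //=.
  exact: measurable_funM.
have G0 p : 0 <= G p by rewrite mule_ge0// lee_fin.
pose K (t : R) : \bar R := \int[mu]_b G (b, t).
have mK : measurable_fun setT K  by
    exact: (@measurable_fun_fubini_tonelli_G _ _ (measurableTypeR R) (measurableTypeR R) R mu G).
have K0 t : 0 <= K t by exact: integral_ge0.
transitivity (\int[mu]_b \int[mu]_t G (b, t)).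
  apply: eq_integral => b _; rewrite /G/=.
  have [b0|b0] := ltP 0%R b; last first.
    by rewrite posF// mul0r mul0e integral0_eq// => t _; rewrite mul0e.
  rewrite posT// mul1e mul1r.
  rewrite (@ge0_affine_substitution _ b 0 (fun a => F (a, b))) ?gt_eqF//; last first.
    exact: (measurable_fun_pair1 _ mF).
  by apply: eq_integral => t _; rewrite gtr0_norm// addr0.
transitivity (\int[mu]_t K t).
  exact: (@fubini_tonelli _ _ (measurableTypeR R) (measurableTypeR R) R mu mu G mG G0).
rewrite (ge0_tan_substitution mK K0).
pose L (t : R) : \bar R := (\1_(`](- (pi / 2))%R, (pi / 2)%R[) t * ((cos t) ^- 2))%:E * K (tan t).
have mL : measurable_fun setT L.
  apply: emeasurable_funM; last exact: measurableT_comp mK measurable_tan.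
  apply/measurable_EFinP/measurable_funM; first exact: measurable_indic.
  by apply: (measurableT_comp measurable_invr); apply: measurable_funX; exact: measurable_cos.
rewrite -[LHS]/(\int[mu]_t L t).
(* The reflection [pi / 2 - th] turns [tan] into the cotangent and the window []-pi/2, pi/2[] into
   []0, pi[]. *)
rewrite (@ge0_affine_substitution _ (-1) (pi / 2) L) ?oppr_eq0//; last first.
  by move=> t; rewrite mule_ge0// lee_fin mulr_ge0// invr_ge0 sqr_ge0.
pose M (p : R * R) : \bar R := (pos p.1 * p.1 * \1_(`]0%R, pi[) p.2)%:E *
                           F (p.1 * cos p.2, p.1 * sin p.2)%R.
have mM : measurable_fun setT M.
  apply: emeasurable_funM.
    apply/measurable_EFinP; apply: measurable_funM => //.
      by apply: measurable_funM => //; exact: (measurableT_comp measurable_pos).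
    by apply: measurableT_comp => //; exact: measurable_indic.
  apply: (measurableT_comp mF); apply: measurable_fun_pair => //=; apply: measurable_funM => //.
    exact: (measurableT_comp measurable_cos).
  exact: (measurableT_comp measurable_sin).
have M0 p : 0 <= M p by rewrite mule_ge0// lee_fin mulr_ge0.
rewrite -[RHS]/(\int[mu]_r \int[mu]_th M (r, th)).
transitivity (\int[mu]_th \int[mu]_r M (r, th)); last first.
  exact/esym/(@fubini_tonelli _ _ (measurableTypeR R) (measurableTypeR R) R mu mu M mM M0).
rewrite /M /=.
apply: eq_integral => th _.
rewrite normrN1 mul1e mulN1r (addrC (- th)%R) /L.
have [/andP[th0 thp]|thn] := boolP ((0 < th < pi)%R); last first.
  rewrite indicE memNset ?mul0r ?mul0e; last first.
    by rewrite /= in_itv/=; apply: contraNnot thn => /andP[? ?]; apply/andP; split; lra.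
  rewrite integral0_eq// => r _; by rewrite (indic_itvE `]0%R, pi[) in_itv/= (negbTE thn) mulr0 mul0e.
have sp : (0 < sin th)%R by rewrite sin_gt0_pi// th0.
rewrite indicE mem_set ?mul1r; last by rewrite /= in_itv/=; apply/andP; split; lra.
have -> : cos (pi / 2 - th) = sin th by rewrite cosB cos_pihalf sin_pihalf mul0r add0r mul1r.
have -> : tan (pi / 2 - th) = (cos th / sin th)%R.
  by rewrite /tan sinB cosB cos_pihalf sin_pihalf !mul0r add0r mul1r subr0 mul1r.
(* Here [b = r sin th]. The factors [sin^-2] from [tan], [sin] from this step and [r sin] from [G]
   multiply to the Jacobian [r]. *)
rewrite /K (@ge0_affine_substitution _ (sin th) 0 (fun b => G (b, cos th / sin th)%R)) ?gt_eqF//; last first.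
  exact: (measurable_fun_pair1 _ mG).
rewrite -ge0_integralZl//; last 3 first.
- apply: emeasurable_funM => //; apply: (measurableT_comp mG); apply: measurable_fun_pair => //.
  by apply: measurable_funD => //; exact: measurable_funM.
- by move=> r _; rewrite mule_ge0.
- by rewrite lee_fin invr_ge0 sqr_ge0.
apply: eq_integral => r _.
rewrite /G/= addr0 gtr0_norm//.
have [r0|r0] := ltP 0%R r; last first.
  rewrite !posF//; last by rewrite pmulr_rle0.
  by rewrite !mul0r !mul0e !mule0.
rewrite !posT ?mulr_gt0// !mul1r.
rewrite (indic_itvE `]0%R, pi[) in_itv/= th0 thp mulr1.
have -> : (sin th * r * (cos th / sin th) = r * cos th)%R by field; rewrite gt_eqF.
rewrite (mulrC r (sin th)) !muleA -!EFinM; congr (_%:E * _).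
by field; rewrite gt_eqF.
Qed.

(** The plane is cut along [b = 0]. The lower half is reflected onto the upper one through [F'], and
    its angle is afterwards reflected by [2 pi - ph], which moves []0, pi[] to []pi, 2 pi[]. The
    angles 0, [pi] and [2 pi] missed by the open arcs are null. *)
Lemma polar_coordinates (F : R * R -> \bar R) :
  measurable_fun setT F -> (forall p, 0 <= F p) ->
  \int[mu]_a \int[mu]_b F (a, b) =
  \int[mu]_r \int[mu]_ph ((pos r * r * \1_(`[0%R, (2 * pi)%R]) ph)%:E *
                           F (r * cos ph, r * sin ph)%R).
Proof.
move=> mF F0.
have pos0 (r : R) : (0 <= pos r * r)%R.
  by have [r0|r0] := ltP 0%R r; [rewrite posT// mul1r ltW|rewrite posF// mul0r].
pose I (b : R) : \bar R := \int[mu]_a F (a, b).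
have mI : measurable_fun setT I by
  exact: (@measurable_fun_fubini_tonelli_G _ _ (measurableTypeR R) (measurableTypeR R) R mu F).
have I0 b : 0 <= I b by exact: integral_ge0.
transitivity (\int[mu]_b I b).
  exact: (@fubini_tonelli _ _ (measurableTypeR R) (measurableTypeR R) R mu mu F mF F0).
have mposI : measurable_fun setT (fun b : R => (pos b)%:E * I b).
  by apply: emeasurable_funM => //; apply/measurable_EFinP; exact: measurable_pos.
have mposNI : measurable_fun setT (fun b : R => (pos (- b)%R)%:E * I b).
  by apply: emeasurable_funM => //; apply/measurable_EFinP; exact: (measurableT_comp measurable_pos).
transitivity (\int[mu]_b ((pos b)%:E * I b + (pos (- b)%R)%:E * I b)).
  apply: (@ge0_integral_eq_off [:: 0%R]) => //.
  - exact: emeasurable_funD.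
  - by move=> t; rewrite adde_ge0// mule_ge0// lee_fin.
  - move=> t; rewrite inE => t0; have [tp|tn] := ltP 0%R t.
      by rewrite posT// posF ?oppr_le0 1?ltW// mul1e mul0e adde0.
    by rewrite posF// posT ?mul1e ?mul0e ?add0e// oppr_gt0 lt_neqAle t0.
rewrite ge0_integralD//; last 2 first.
- by move=> t _; rewrite mule_ge0// lee_fin.
- by move=> t _; rewrite mule_ge0// lee_fin.
rewrite half_polar_coordinates//.
rewrite (@ge0_affine_substitution _ (-1) 0 (fun b => (pos (- b)%R)%:E * I b))//; last first.
  by move=> t; rewrite mule_ge0// lee_fin.
pose F' (p : R * R) : \bar R := F (p.1, - p.2)%R.
have mF' : measurable_fun setT F'.
  by apply: (measurableT_comp mF); apply: measurable_fun_pair => //; exact: measurableT_comp.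
transitivity (\int[mu]_r \int[mu]_th ((pos r * r * \1_(`]0%R, pi[) th)%:E *
                           F (r * cos th, r * sin th)%R) +
    \int[mu]_b ((pos b)%:E * \int[mu]_a F' (a, b))).
  congr (_ + _); apply: eq_integral => b _.
  by rewrite normrN1 mul1e mulN1r addr0 opprK.
rewrite (half_polar_coordinates mF'); last by move=> p; exact: F0.
have F'0 p : 0 <= F' p by exact: F0.
have mW (i : interval R) (s : R) : measurable_fun setT (fun p : R * R =>
    (pos p.1 * p.1 * \1_([set` i]) p.2)%:E * F (p.1 * cos p.2, s * (p.1 * sin p.2))%R).
  apply: emeasurable_funM.
    apply/measurable_EFinP; apply: measurable_funM => //.
      by apply: measurable_funM => //; exact: (measurableT_comp measurable_pos).
    by apply: measurableT_comp => //; exact: measurable_indic.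
  apply: (measurableT_comp mF); apply: measurable_fun_pair => //=; apply: measurable_funM => //.
    exact: (measurableT_comp measurable_cos).
  by apply: measurable_funM => //; exact: (measurableT_comp measurable_sin).
have W0 (i : interval R) (s : R) (p : R * R) :
    0 <= (pos p.1 * p.1 * \1_([set` i]) p.2)%:E * F (p.1 * cos p.2, s * (p.1 * sin p.2))%R.
  by rewrite mule_ge0// lee_fin mulr_ge0.
have mW1 (i : interval R) : measurable_fun setT (fun p : R * R =>
    (pos p.1 * p.1 * \1_([set` i]) p.2)%:E * F (p.1 * cos p.2, p.1 * sin p.2)%R).
  by have := mW i 1%R; under eq_fun do rewrite mul1r.
have W1 (i : interval R) (p : R * R) :
    0 <= (pos p.1 * p.1 * \1_([set` i]) p.2)%:E * F (p.1 * cos p.2, p.1 * sin p.2)%R.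
  by rewrite mule_ge0// lee_fin mulr_ge0.
have mW1N (i : interval R) : measurable_fun setT (fun p : R * R =>
    (pos p.1 * p.1 * \1_([set` i]) p.2)%:E * F' (p.1 * cos p.2, p.1 * sin p.2)%R).
  by have := mW i (-1)%R; under eq_fun do rewrite mulN1r.
have W1N (i : interval R) (p : R * R) :
    0 <= (pos p.1 * p.1 * \1_([set` i]) p.2)%:E * F' (p.1 * cos p.2, p.1 * sin p.2)%R.
  by rewrite mule_ge0// lee_fin mulr_ge0.
have mA (i : interval R) (r : R) : measurable_fun setT (fun t : R =>
    (pos r * r * \1_([set` i]) t)%:E * F (r * cos t, r * sin t)%R) :=
  measurable_fun_pair2 r (mW1 i).
have mD (i : interval R) (r : R) : measurable_fun setT (fun t : R =>
    (pos r * r * \1_([set` i]) t)%:E * F' (r * cos t, r * sin t)%R) :=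
  measurable_fun_pair2 r (mW1N i).
rewrite -ge0_integralD//; last 4 first.
- by move=> r _; apply: integral_ge0 => t _; exact: (W1 `]0%R, pi[ (r, t)).
- exact: (@measurable_fun_fubini_tonelli_F _ _ (measurableTypeR R) (measurableTypeR R) R mu _ (mW1 `]0%R, pi[) (W1 `]0%R, pi[)).
- by move=> r _; apply: integral_ge0 => t _; exact: (W1N `]0%R, pi[ (r, t)).
- exact: (@measurable_fun_fubini_tonelli_F _ _ (measurableTypeR R) (measurableTypeR R) R mu _ (mW1N `]0%R, pi[) (W1N `]0%R, pi[)).
apply: eq_integral => r _.
rewrite (@ge0_affine_substitution _ (-1) (2 * pi)%R (fun th => (pos r * r * \1_(`]0%R, pi[) th)%:E *
   F' (r * cos th, r * sin th)%R)) ?oppr_eq0//; last first.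
  by move=> t; rewrite mule_ge0// lee_fin mulr_ge0.
have -> : \int[mu]_t (`|(-1)%R|%:E * ((pos r * r * \1_(`]0%R, pi[) (-1 * t + 2 * pi)%R)%:E *
     F' (r * cos (-1 * t + 2 * pi), r * sin (-1 * t + 2 * pi))%R)) =
   \int[mu]_t ((pos r * r * \1_(`]pi, (2 * pi)%R[) t)%:E * F (r * cos t, r * sin t)%R).
  apply: eq_integral => t _.
  rewrite normrN1 mul1e mulN1r /F'/= addrC.
  rewrite cosB sinB mulr_natl cos2pi sin2pi !mul1r !mul0r addr0 sub0r mulrN opprK.
  congr ((_ * _)%:E * _); rewrite !indic_itvE !in_itv/=; congr (nat_of_bool _)%:R.
  by apply/idP/idP => /andP[? ?]; apply/andP; split; lra.
rewrite -ge0_integralD//; last 4 first.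
- by move=> t _; rewrite mule_ge0// lee_fin mulr_ge0.
- exact: mA.
- by move=> t _; rewrite mule_ge0// lee_fin mulr_ge0.
- exact: mA.
apply: (@ge0_integral_eq_off [:: 0%R; pi; (2 * pi)%R]) => //.
- exact: emeasurable_funD.
- by move=> t; rewrite adde_ge0// mule_ge0// lee_fin mulr_ge0.
- by move=> t; rewrite mule_ge0// lee_fin mulr_ge0.
move=> t; rewrite !inE !negb_or => /and3P[t0 tpi t2pi].
have pp := pi_gt0 R.
rewrite !indic_itvE !in_itv/=.
have [tp|tp] := ltP t pi.
  rewrite andbT [(pi < t)%R]ltNge (ltW tp)/= mulr0 mul0e adde0.
  rewrite (_ : (t <= 2 * pi)%R) ?andbT; last by lra.
  by rewrite [(0 <= t)%R]le_eqVlt eq_sym (negbTE t0).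
have pt : (pi < t)%R by rewrite lt_neqAle eq_sym tpi.
have t0' : (0 <= t)%R by lra.
by rewrite pt t0' andbF mulr0 mul0e add0e [(t <= 2 * pi)%R]le_eqVlt (negbTE t2pi).
Qed.

Lemma ge0_translation (c : R) (F : R -> \bar R) :
  measurable_fun setT F -> (forall t, 0 <= F t) ->
  \int[mu]_t F t = \int[mu]_t F (t + c)%R.
Proof.
move=> mF F0; rewrite (@ge0_affine_substitution _ 1 c F)//.
by apply: eq_integral => t _; rewrite normr1 mul1e mul1r.
Qed.

(** Cylindrical coordinates come first: for a fixed height, the horizontal plane is put in polar
    form. The height and the cylindrical radius then range over a half-plane, to which half-polar
    coordinates apply. The two Jacobians are [r sin th] and [r], with product [r^2 sin th]. *)
Lemma spherical_coordinates (c1 c2 c3 : R) (G : R * R * R -> \bar R) :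
  measurable_fun setT G -> (forall p, 0 <= G p) ->
  \int[leb3 R]_y G y =
  \int[mu]_r \int[mu]_th \int[mu]_ph
    ((pos r * r ^+ 2 * (\1_(`[0%R, pi]) th * sin th * \1_(`[0%R, (2 * pi)%R]) ph))%:E *
      G (mkpt3 (c1 + r * sin th * cos ph) (c2 + r * sin th * sin ph) (c3 + r * cos th))).
Proof.
move=> mG G0.
have pos0 (r : R) : (0 <= pos r * r)%R.
  by have [r0|r0] := ltP 0%R r; [rewrite posT// mul1r ltW|rewrite posF// mul0r].
pose W (q : R * R * R) : \bar R := (pos q.1.2 * q.1.2 * \1_(`[0%R, (2 * pi)%R]) q.2)%:E *
  G ((q.1.2 * cos q.2 + c1, q.1.2 * sin q.2 + c2), q.1.1 + c3)%R.
have m11 : measurable_fun setT (fun q : R * R * R => q.1.1) by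
  exact: (measurableT_comp measurable_fst measurable_fst).
have m12 : measurable_fun setT (fun q : R * R * R => q.1.2) by
  exact: (measurableT_comp measurable_snd measurable_fst).
have m2 : measurable_fun setT (fun q : R * R * R => q.2) by exact: measurable_snd.
have mW : measurable_fun setT W.
  apply: emeasurable_funM.
    apply/measurable_EFinP; apply: measurable_funM => //.
      by apply: measurable_funM => //; exact: (measurableT_comp measurable_pos m12).
    by apply: (measurableT_comp _ m2); exact: measurable_indic.
  apply: (measurableT_comp mG); apply: measurable_fun_pair => /=.
    apply: measurable_fun_pair => /=; apply: measurable_funD => //; apply: measurable_funM => //.
      exact: (measurableT_comp measurable_cos m2).
    exact: (measurableT_comp measurable_sin m2).
  exact: measurable_funD.
have W0 q : 0 <= W q by rewrite mule_ge0// lee_fin mulr_ge0.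
pose H (p : R * R) : \bar R := \int[mu]_ph W (p, ph).
have mH : measurable_fun setT H.
  exact: (@measurable_fun_fubini_tonelli_F _ _ (measurableTypeR R * measurableTypeR R)%type (measurableTypeR R) R mu W mW W0).
have H0 p : 0 <= H p by exact: integral_ge0.
have Gc c : measurable_fun setT (fun p : R * R => G (p, c)) := measurable_fun_pair1 c mG.
have Gac a c : measurable_fun setT (fun b : R => G (a, b, c)) := measurable_fun_pair2 a (Gc c).
pose K (c : R) : \bar R := \int[leb2 R]_p G (p, c).
have mK : measurable_fun setT K.
  exact: (@measurable_fun_fubini_tonelli_G _ _ (measurableTypeR R * measurableTypeR R)%type (measurableTypeR R) R (leb2 R) G mG G0).
have K0 c : 0 <= K c by exact: integral_ge0.
transitivity (\int[mu]_c K c).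
  exact: (@fubini_tonelli2 _ _ (measurableTypeR R * measurableTypeR R)%type (measurableTypeR R) R (leb2 R) mu G mG G0).
rewrite (ge0_translation c3 mK K0).
transitivity (\int[mu]_c \int[mu]_r H (c, r)).
  apply: eq_integral => c _; rewrite /K.
  pose I (a : R) : \bar R := \int[mu]_b G (a, b, c + c3)%R.
  have mI : measurable_fun setT I.
    exact: (@measurable_fun_fubini_tonelli_F _ _ (measurableTypeR R) (measurableTypeR R) R mu (fun p => G (p, c + c3)%R) (Gc _)).
  transitivity (\int[mu]_a I a).
    exact: (@fubini_tonelli1 _ _ (measurableTypeR R) (measurableTypeR R) R mu mu (fun p => G (p, c + c3)%R) (Gc _)).
  rewrite (ge0_translation c1 mI); last by move=> a; exact: integral_ge0.
  pose F (p : R * R) : \bar R := G (p.1 + c1, p.2 + c2, c + c3)%R.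
  have mF : measurable_fun setT F.
    by apply: (measurableT_comp mG); apply: measurable_fun_pair => //; apply: measurable_fun_pair => //; exact: measurable_funD.
  transitivity (\int[mu]_a \int[mu]_b F (a, b)).
    by apply: eq_integral => a _; rewrite /I (ge0_translation c2 (Gac _ _)).
  exact: (polar_coordinates mF (fun p => G0 _)).
transitivity (\int[mu]_r \int[mu]_c H (c, r)).
  exact: (@fubini_tonelli _ _ (measurableTypeR R) (measurableTypeR R) R mu mu H mH H0).
(* The cutoff is already contained in [W]; repeating it gives the form that [half_polar_coordinates]
   expects. *)
transitivity (\int[mu]_r ((pos r)%:E * \int[mu]_c H (c, r))).
  apply: eq_integral => r _; have [r0|r0] := ltP 0%R r; first by rewrite posT// mul1e.
  rewrite posF// mul0e integral0_eq// => c _.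
  by rewrite /H integral0_eq// => ph _; rewrite /W/= posF// !mul0r mul0e.
rewrite half_polar_coordinates//.
apply: eq_integral => r _; apply: eq_integral => th _.
rewrite /H -ge0_integralZl//; last 2 first.
- exact: (measurable_fun_pair2 (r * cos th, r * sin th)%R mW).
- by rewrite lee_fin mulr_ge0.
apply: eq_integral => ph _.
rewrite /W/= muleA -EFinM /mkpt3 (addrC c1) (addrC c2) (addrC c3); congr (_%:E * _).
have [r0|r0] := ltP 0%R r; last by rewrite posF// !mul0r.
rewrite (posT r0) (indic_itvE `]0%R, pi[) (indic_itvE `[0%R, pi]) !in_itv/=.
(* The open and the closed range of [th] differ at 0 and [pi] only, where the factor [sin th]
   vanishes. *)
have [/andP[th0 thp]|/negbTE thn] := boolP ((0 < th < pi)%R).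
  by rewrite posT ?mulr_gt0 ?sin_gt0_pi ?th0//= !ltW//=; ring.
rewrite mulr0 mul0r.
suff -> : ((0 <= th <= pi)%R%:R * sin th = 0 :> R)%R by rewrite mul0r mulr0.
have [thb|] := boolP ((0 <= th <= pi)%R); last by rewrite mul0r.
rewrite mul1r; move/negbT: thn; rewrite negb_and -!leNgt => /orP[h|h].
  have -> : th = 0%R; last exact: sin0.
  by apply/eqP; rewrite eq_le h; case/andP: thb.
have -> : th = pi; last exact: sinpi.
by apply/eqP; rewrite eq_le h andbT; case/andP: thb.
Qed.

End polar_coordinates.

(** * The moment problem on a bounded interval *)

Section moment_problem.
Context {R : realType}.
Local Notation mu := (@lebesgue_measure R).

(* The polynomials [(1 - t^n)^(2^n)] tend boundedly on [[0, 1]] to the indicator of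
   [t < 1/2], off [t = 1/2]; composed with affine maps they give initial segments. *)
Lemma one_minus_expr_ge (x : R) (m : nat) : 0 <= x <= 1 -> 1 - m%:R * x <= (1 - x) ^+ m.
Proof.
move=> /andP[x0 x1]; elim: m => [|m IH]; first by rewrite mul0r subr0 expr0.
rewrite exprS; apply: (@le_trans _ _ ((1 - x) * (1 - m%:R * x))); last first.
  by rewrite ler_wpM2l// subr_ge0.
have : 0 <= m%:R * (x * x) by rewrite mulr_ge0// mulr_ge0.
rewrite -natr1; nra.
Qed.

(** Division-free form of [(1 - x)^m <= 1 / (1 + m x)], the upper counterpart of Bernoulli's
    inequality. *)
Lemma one_minus_expr_le (x : R) (m : nat) : 0 <= x <= 1 -> (1 - x) ^+ m * (1 + m%:R * x) <= 1.
Proof.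
move=> /andP[x0 x1]; elim: m => [|m IH]; first by rewrite mul0r addr0 expr0 mulr1.
apply: le_trans IH; rewrite exprSr -mulrA ler_wpM2l ?exprn_ge0 ?subr_ge0//.
have : 0 <= m%:R * (x * x) by rewrite mulr_ge0// mulr_ge0.
rewrite -natr1; nra.
Qed.

(** The exponent [2 ^ n] puts the threshold at 1/2, because [2^n t^n = (2 t)^n]. Bernoulli squeezes
    the sequence between [1 - (2 t)^n] and 1; above the threshold the companion inequality bounds it
    by [(2 t)^-n]. *)
Lemma cvg_step_lt (t : R) : 0 <= t -> t < 2^-1 -> (1 - t ^+ n) ^+ (2 ^ n) @[n --> \oo] --> (1 : R).
Proof.
move=> t0 t2.
have tn n : 0 <= t ^+ n <= 1 by rewrite exprn_ge0//= exprn_ile1//; lra.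
apply: (@squeeze_cvgr _ _ _ _ (fun n => 1 - (2 * t) ^+ n) (fun=> 1)).
- near=> n; rewrite exprMn -natrX one_minus_expr_ge//= exprn_ile1// ?subr_ge0.
    by case/andP: (tn n).
  by rewrite gerBl; case/andP: (tn n).
- rewrite -[X in _ --> X]subr0; apply: cvgB; first exact: cvg_cst.
  by apply: cvg_expr; rewrite ger0_norm; lra.
- exact: cvg_cst.
Unshelve. all: by end_near. Qed.

Lemma cvg_step_gt (t : R) : 2^-1 < t -> t <= 1 -> (1 - t ^+ n) ^+ (2 ^ n) @[n --> \oo] --> (0 : R).
Proof.
move=> t2 t1.
have tn n : 0 <= t ^+ n <= 1 by rewrite exprn_ge0 ?exprn_ile1//; lra.
apply: (@squeeze_cvgr _ _ _ _ (fun=> 0) (fun n => ((2 * t)^-1) ^+ n)).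
- near=> n; rewrite exprn_ge0/=; last by rewrite subr_ge0; case/andP: (tn n).
  rewrite exprVn -[leRHS]mul1r ler_pdivlMr; last by rewrite exprn_gt0//; lra.
  apply: le_trans (one_minus_expr_le (2 ^ n) (tn n)).
  rewrite ler_wpM2l//; last by rewrite exprMn natrX lerDr.
  by rewrite exprn_ge0// subr_ge0; case/andP: (tn n).
- exact: cvg_cst.
- apply: cvg_expr; rewrite ger0_norm ?invr_ge0; last by lra.
  by rewrite invf_lt1; lra.
Unshelve. all: by end_near. Qed.

(** The map sends the cut [c] to the threshold 1/2. Its slope [1 / (2 l)] keeps [[0, l]] inside
    [[0, 1]], since [|r - c| <= l]. *)
Lemma affine_unit_interval (l c r : R) : 0 < l -> 0 <= c <= l -> 0 <= r <= l ->
  0 <= 2^-1 + (r - c) / (2 * l) <= 1.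
Proof.
move=> l0 /andP[c0 cl] /andP[r0 rl]; have l2 : 0 < 2 * l by rewrite mulr_gt0.
have -> : 2^-1 + (r - c) / (2 * l) = (l + r - c) / (2 * l) by field; rewrite gt_eqF.
rewrite divr_ge0/=; [|lra|lra].
by rewrite ler_pdivrMr//; lra.
Qed.

(** The bound is asked only where [h] does not vanish, which admits multipliers such as powers of
    [r] or the inverse distance that are unbounded elsewhere. *)
Lemma integrable_bounded_mul d (T : measurableType d) (m : {measure set T -> \bar R})
    (C : R) (phi h : T -> R) :
  measurable_fun setT phi -> m.-integrable setT (EFin \o h) ->
  (forall r, h r != 0 -> `|phi r| <= C) ->
  m.-integrable setT (EFin \o (fun r => phi r * h r)).
Proof.
move=> mphi ih bphi.
have /integrableP[/measurable_EFinP mh _] := ih.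
apply: (@le_integrable _ _ _ m setT measurableT _ (fun r => C%:E * (h r)%:E)%E).
- by apply/measurable_EFinP; exact: measurable_funM.
- move=> r _ /=; rewrite lee_fin !normrM.
  have [->|h0] := eqVneq (h r) 0; first by rewrite normr0 !mulr0.
  apply: ler_wpM2r => //; apply: le_trans (bphi r h0) _; exact: ler_norm.
- exact: integrableZl.
Qed.

Context (L : R) (h : R -> R).
Hypothesis L0 : 0 < L.
Hypothesis ih : mu.-integrable setT (EFin \o h).
Hypothesis h_supp : forall r, h r != 0 -> 0 <= r <= L.

Lemma integrable_continuous_mul (phi : R -> R) : continuous phi ->
  mu.-integrable setT (EFin \o (fun r => phi r * h r)).
Proof.
move=> cphi.
have [C HC] : exists C, forall r, r \in `[0, L] -> `|phi r| <= C.
  have cn : {within `[0, L], continuous (fun r => `|phi r|)}.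
    apply: continuous_subspaceT => r.
    by apply: continuous_comp; [exact: cphi|exact: norm_continuous].
  have [c _ Hc] := EVT_max (ltW L0) cn; by exists `|phi c|.
apply: (@integrable_bounded_mul _ _ mu C) => //.
- exact: continuous_measurable_fun.
- by move=> r /h_supp hr; apply: HC; rewrite in_itv.
Qed.

Lemma integral_horner_eq0 (p : {poly R}) :
  (forall n, (\int[mu]_r (r ^+ n * h r) = 0)%R) ->
  (\int[mu]_r (p.[r] * h r) = 0)%R.
Proof.
move=> mom.
(* The extra power of [r] makes the induction go through: the Horner step [p * 'X + c] raises the
   exponent by one. *)
suff : forall n, (\int[mu]_r (p.[r] * r ^+ n * h r) = 0)%R.
  by move=> /(_ 0%N); under eq_Rintegral do rewrite expr0 mulr1.
elim/poly_ind: p => [|p c IH] n.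
  under eq_Rintegral do rewrite horner0 !mul0r.
  by rewrite Rintegral_cst// mul0r.
have cX k : continuous (fun r : R => r ^+ k) by exact: exprn_continuous.
transitivity (\int[mu]_r (p.[r] * r ^+ n.+1 * h r + c * (r ^+ n * h r)))%R.
  by apply: eq_Rintegral => r _; rewrite hornerMXaddC exprS; ring.
rewrite RintegralD//; last 2 first.
- apply: (@integrable_continuous_mul (fun r => p.[r] * r ^+ n.+1)) => r.
  by apply: continuousM; [exact: continuous_horner|exact: cX].
- apply: eq_integrable (integrableZl measurableT c (integrable_continuous_mul (cX n))) => //.
rewrite IH add0r RintegralZl//; last exact: (@integrable_continuous_mul (fun r => r ^+ n)).
by rewrite mom mulr0.
Qed.

(** Each [q n] is a polynomial, so its integral against [h] is 0. On the support of [h] its values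
    lie in [[0, 1]], so [|h|] dominates, and the limit is the integral of [h] up to [c]. *)
Lemma integral_initial_eq0 (c : R) : 0 <= c <= L ->
  (forall n, (\int[mu]_r (r ^+ n * h r) = 0)%R) ->
  (\int[mu]_(r in `]-oo, c]) h r = 0)%R.
Proof.
move=> /andP[c0 cL] mom.
pose t (r : R) := 2^-1 + (r - c) / (2 * L).
pose q n : {poly R} := (1 - ((2^-1 - c / (2 * L))%:P + (2 * L)^-1 *: 'X) ^+ n) ^+ (2 ^ n).
have qE n r : (q n).[r] = (1 - t r ^+ n) ^+ (2 ^ n).
  rewrite /q !(hornerE, horner_exp); congr ((1 - _ ^+ _) ^+ _).
  by rewrite /t; field; rewrite gt_eqF.
have t01 r : 0 <= r <= L -> 0 <= t r <= 1.
  by move=> rL; apply: affine_unit_interval => //; rewrite c0.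
have tc r : (t r < 2^-1) = (r < c).
  by rewrite /t -ltrBrDl subrr pmulr_llt0 ?invr_gt0 ?mulr_gt0// subr_lt0.
have ct r : (2^-1 < t r) = (c < r).
  by rewrite /t -ltrBlDl subrr pmulr_lgt0 ?invr_gt0 ?mulr_gt0// subr_gt0.
have mh : measurable_fun setT h by have /integrableP[/measurable_EFinP] := ih.
have iq n : mu.-integrable setT (fun r => ((q n).[r] * h r)%:E).
  by apply: integrable_continuous_mul; exact: continuous_horner.
pose g (r : R) : R := if r <= c then h r else 0.
have gE : h \_ `]-oo, c] = g.
  by apply/funext => r; rewrite patchE mem_setE in_itv.
have mg : measurable_fun setT g.
  by rewrite -gE; apply/(measurable_restrictT h) => //; exact: measurable_funTS.
have cvgq r : r != c -> (fun n => (q n).[r] * h r) @ \oo --> g r.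
  move=> rc.
  rewrite (_ : (fun n => _) = fun n => (1 - t r ^+ n) ^+ (2 ^ n) * h r); last first.
    by apply/funext => n; rewrite qE.
  have [hr0|/h_supp /t01 /andP[tr0 tr1]] := eqVneq (h r) 0.
    rewrite (_ : g r = 0); last by rewrite /g hr0 if_same.
    rewrite (_ : (fun n => _) = cst 0); first exact: cvg_cst.
    by apply/funext => n; rewrite hr0 mulr0.
  have [rlc|crlt] := ltP r c.
    have -> : g r = 1 * h r by rewrite /g ltW// mul1r.
    by apply: cvgMr_tmp; apply: cvg_step_lt => //; rewrite tc.
  have {}crlt : c < r by rewrite lt_neqAle eq_sym rc.
  have -> : g r = 0 * h r by rewrite /g leNgt crlt mul0r.
  by apply: cvgMr_tmp; apply: cvg_step_gt => //; rewrite ct.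
have [//| | | | | _ _] := @dominated_convergence _ (measurableTypeR R) R mu setT measurableT
  (fun n r => ((q n).[r] * h r)%:E) (EFin \o g) (fun r => `|h r|%:E).
- by move=> n; exact: measurable_int (iq n).
- exact/measurable_EFinP.
- exists [set c]; split; first exact: measurable_set1.
    exact: lebesgue_measure_set1.
  move=> r /= H; apply: contrapT => /eqP rc; apply: H => _.
  by apply/fine_cvgP; split; [exact: nearW|exact: cvgq].
- exact: integrable_norm.
- apply: aeW => r n _; rewrite lee_fin normrM qE.
  have [->|/h_supp /t01 /andP[tr0 tr1]] := eqVneq (h r) 0; first by rewrite normr0 mulr0.
  have tn : 0 <= t r ^+ n <= 1 by rewrite exprn_ge0//= exprn_ile1.
  rewrite ler_piMl// ger0_norm ?exprn_ge0 ?exprn_ile1 ?subr_ge0 ?gerBl//; by case/andP: tn.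
have q0 n : (\int[mu]_x ((q n).[x] * h x)%:E)%E = 0%E.
  rewrite -[LHS]fineK; last exact: integrable_fin_num (iq n).
  by congr EFin; exact: integral_horner_eq0.
under eq_fun do rewrite q0.
move=> /cvg_lim; rewrite lim_cst// => /(_ _) H.
by rewrite Rintegral_mkcond gE /Rintegral -H.
Qed.

(** The primitive of [h] vanishes identically, and Lebesgue differentiation recovers [h] almost
    everywhere as its derivative. *)
Lemma moments_eq0 : (forall n, (\int[mu]_r (r ^+ n * h r) = 0)%R) ->
  {ae mu, forall r, h r = 0}.
Proof.
move=> mom.
have F0 c : (\int[mu]_(r in `]-oo, c]) h r = 0)%R.
  have [c0|c0] := ltP c 0.
    under eq_Rintegral.
      move=> r; rewrite inE/= in_itv/= => rc.
      have -> : h r = 0.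
        by apply: contrapT => /eqP /h_supp /andP[r0 _]; move: (le_lt_trans rc c0); rewrite ltNge r0.
      over.
    by rewrite Rintegral_cst// mul0r.
  have [cL|Lc] := leP c L; first by apply: integral_initial_eq0 => //; rewrite c0.
  (* Beyond [L] the initial integral is the whole integral, that is the moment of order 0. *)
  have := mom 0%N; under eq_Rintegral do rewrite expr0 mul1r.
  move=> <-; rewrite Rintegral_mkcond; apply: eq_Rintegral => r _.
  rewrite patchE mem_setE in_itv/=; case: ifPn => // rc.
  apply/esym; apply: contrapT => /eqP /h_supp /andP[_ rL].
  by move: rc; rewrite (le_trans rL (ltW Lc)).
have loc : locally_integrable [set: R] h.
  by apply: open_integrable_locally => //; exact: openT.
have ihy y : mu.-integrable `]-oo, y] (EFin \o h) by exact: integrableS ih.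
have := FTC1Ny ihy loc.
apply: filterS; first exact: (ae_filter_ringOfSetsType mu).
move=> r /= [_ <-].
rewrite derive1E (_ : (fun _ => _) = cst 0) ?derive_cst//.
by apply/funext => y; exact: F0.
Qed.

End moment_problem.

(** * Band-limited uniqueness for the Fourier transform *)

Section fourier_uniqueness.
Context {R : realType}.
Local Notation mu := (@lebesgue_measure R).

(** The function is the real part of [e^{iky} (u + i v)]. Its derivative is the real part of [i y]
    times that number, hence [- y] times its imaginary part. *)
Lemma is_derive_wave (y u v x : R) :
  is_derive x 1 (fun k => cos (k * y) * u - sin (k * y) * v)
    (- (y * (cos (x * y) * v + sin (x * y) * u))).
Proof.
have dl : is_derive x 1 (fun k : R => k * y) y.
  by apply: is_derive_eq; rewrite /= /GRing.scale/=; ring.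
have dc : is_derive x 1 (fun k : R => cos (k * y)) (- sin (x * y) * y).
  exact: (@is_derive1_comp _ (@cos R) (fun k => k * y)).
have ds : is_derive x 1 (fun k : R => sin (k * y)) (cos (x * y) * y).
  exact: (@is_derive1_comp _ (@sin R) (fun k => k * y)).
apply: is_derive_eq.
rewrite /= !scaler0 !add0r /GRing.scale/=; ring.
Qed.

Context (L a b : R).
Hypotheses (L0 : 0 < L) (ab : a < b).

(* [band_null h1 h2]: the real part of the Fourier integral of [h1 + i h2] vanishes
   on [(a, b)]; [band_null h2 (- h1)] is the same for the imaginary part. *)
Definition band_null (h1 h2 : R -> R) := forall k, a < k < b ->
  (\int[mu]_r (cos (k * r) * h1 r - sin (k * r) * h2 r) = 0)%R.

Definition supp_integrable (h : R -> R) :=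
  mu.-integrable setT (EFin \o h) /\ forall r, h r != 0 -> 0 <= r <= L.

Lemma supp_integrable_mul (phi h : R -> R) : continuous phi ->
  supp_integrable h -> supp_integrable (fun r => phi r * h r).
Proof.
move=> cphi [ih sh]; split; first exact: (integrable_continuous_mul L0).
by move=> r; rewrite mulf_eq0 negb_or => /andP[_]; exact: sh.
Qed.

Lemma supp_integrableD (h1 h2 : R -> R) : supp_integrable h1 -> supp_integrable h2 ->
  supp_integrable (fun r => h1 r + h2 r).
Proof.
move=> [ih1 sh1] [ih2 sh2]; split.
  exact: (integrableD measurableT ih1 ih2).
move=> r; have [h10|h10 _] := eqVneq (h1 r) 0; last exact: sh1.
by rewrite h10 add0r; exact: sh2.
Qed.

Lemma continuous_cosM (k : R) : continuous (fun r : R => cos (k * r)).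
Proof. by move=> r; apply: continuous_comp; [exact: mulrl_continuous|exact: continuous_cos]. Qed.

Lemma continuous_sinM (k : R) : continuous (fun r : R => sin (k * r)).
Proof. by move=> r; apply: continuous_comp; [exact: mulrl_continuous|exact: continuous_sin]. Qed.

Lemma supp_integrable_wave (k : R) (h1 h2 : R -> R) :
  supp_integrable h1 -> supp_integrable h2 ->
  supp_integrable (fun r => cos (k * r) * h1 r - sin (k * r) * h2 r).
Proof.
move=> s1 s2; apply: supp_integrableD.
  by apply: supp_integrable_mul => //; exact: continuous_cosM.
have := supp_integrable_mul (phi := fun r => - sin (k * r)) _ s2.
have -> : (fun r => - sin (k * r) * h2 r) = (fun r => - (sin (k * r) * h2 r)).
  by apply/funext => r; rewrite mulNr.
by apply=> r; apply: continuousN; exact: continuous_sinM.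
Qed.

(** Differentiation in [k] multiplies the density [h1 + i h2] by [i r]. The conclusion is stated for
    [- i r], the sign being irrelevant for an integral that vanishes. *)
Lemma band_null_derive (h1 h2 : R -> R) : supp_integrable h1 -> supp_integrable h2 ->
  band_null h1 h2 -> band_null (fun r => r * h2 r) (fun r => - (r * h1 r)).
Proof.
move=> s1 s2 null k kab.
pose f (x y : R) := cos (x * y) * h1 y - sin (x * y) * h2 y.
have Ik : (`]a, b[%classic : set R) k by rewrite /= in_itv.
have df x y := is_derive_wave y (h1 y) (h2 y) x.
(* Dominates the derivative for all frequencies at once: on the support the factor [y] is at most
   [L], and sine and cosine are at most 1. *)
pose G (y : R) := L * (`|h1 y| + `|h2 y|).
have iG : mu.-integrable setT (EFin \o G).
  have := integrableZl measurableT L (integrableD measurableT (integrable_norm s1.1) (integrable_norm s2.1)).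
  exact.
have G0 y : 0 <= G y by apply: mulr_ge0; [exact: ltW|exact: addr_ge0].
have dfE x y : partial1of2 f x y = - (y * (cos (x * y) * h2 y + sin (x * y) * h1 y)).
  by rewrite partial1of2E; have [_ ->] := df x y.
have dfG x y : (`]a, b[%classic : set R) x -> [set: R] y -> `|partial1of2 f x y| <= G y.
  move=> _ _; rewrite dfE normrN.
  have [[h10 h20]|h12] := pselect (h1 y = 0 /\ h2 y = 0).
    by rewrite h10 h20 !mulr0 addr0 mulr0 normr0.
  have /andP[y0 yL] : 0 <= y <= L.
    have [h10|h10] := eqVneq (h1 y) 0; last exact: s1.2.
    by apply: s2.2; apply/eqP => h20; apply: h12.
  rewrite normrM ger0_norm//; apply: ler_pM => //.
  apply: le_trans (ler_normD _ _) _; rewrite addrC !normrM.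
  by apply: lerD; rewrite ler_piMl// ?cos_max ?sin_max// ?ler_norml ?cos_geN1 ?cos_le1 ?sin_geN1 ?sin_le1.
have dfd x y : (`]a, b[%classic : set R) x -> [set: R] y -> derivable (f ^~ y) x 1.
  by move=> _ _; have [] := df x y.
have H := @differentiation_under_integral R _ (measurableTypeR R) mu f setT measurableT k a b Ik
  (fun x _ => (supp_integrable_wave x s1 s2).1) dfd G G0 iG dfG.
have F0 : (fun x => \int[mu]_y f x y)^`()%classic k = 0.
  (* Since [k] is interior to the band, the integral vanishes on a whole neighbourhood and not only
     at [k]. *)
  rewrite derive1E (near_eq_derive (g := cst 0)) ?derive_cst//.
  have : \forall x \near k, x \in `]a, b[ by apply: near_in_itvoo; rewrite in_itv.
  by apply: filterS => x; rewrite in_itv/= => kx; exact: null.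
move: H; rewrite F0 => /esym; under eq_Rintegral do rewrite dfE; move=> H.
apply/eqP; rewrite -oppr_eq0; apply/eqP; rewrite -[RHS]H -mulN1r -RintegralZl//.
  by apply: eq_Rintegral => y _; ring.
have cid : continuous (fun r : R => r) by move=> ?; exact: cvg_id.
have cN : continuous (fun r : R => - r) by move=> ?; exact: continuousN.
have := supp_integrable_mul cN s1.
rewrite (_ : (fun r => - r * h1 r) = (fun r => - (r * h1 r))); last first.
  by apply/funext => r; rewrite mulNr.
move=> s1'; exact: (supp_integrable_wave k (supp_integrable_mul cid s2) s1').1.
Qed.

Lemma supp_integrableN (h : R -> R) : supp_integrable h -> supp_integrable (fun r => - h r).
Proof.
move=> s; have c1 : continuous (fun _ : R => -1 : R) by move=> ?; exact: cvg_cst.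
have := supp_integrable_mul c1 s.
by rewrite (_ : (fun r => -1 * h r) = (fun r => - h r))//; apply/funext => r; rewrite mulN1r.
Qed.

Lemma band_nullN (h1 h2 : R -> R) : supp_integrable h1 -> supp_integrable h2 ->
  band_null h1 h2 -> band_null (fun r => - h1 r) (fun r => - h2 r).
Proof.
move=> s1 s2 null k kab.
transitivity (-1 * \int[mu]_r (cos (k * r) * h1 r - sin (k * r) * h2 r))%R; last first.
  by rewrite null// mulr0.
rewrite -RintegralZl//; last exact: (supp_integrable_wave k s1 s2).1.
by apply: eq_Rintegral => r _; ring.
Qed.

(** The two conditions are carried jointly because a derivative exchanges them up to sign: the real
    part at [n] yields the imaginary part at [n.+1], and conversely. *)
Lemma band_null_moment (h1 h2 : R -> R) (n : nat) :
  supp_integrable h1 -> supp_integrable h2 ->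
  band_null h1 h2 -> band_null h2 (fun r => - h1 r) ->
  band_null (fun r => r ^+ n * h1 r) (fun r => r ^+ n * h2 r) /\
  band_null (fun r => r ^+ n * h2 r) (fun r => - (r ^+ n * h1 r)).
Proof.
move=> s1 s2 n1 n2.
have cX k : continuous (fun r : R => r ^+ k) by exact: exprn_continuous.
elim: n => [|n [IH1 IH2]].
  have E0 (h : R -> R) : (fun r => r ^+ 0 * h r) = h.
    by apply/funext => r; rewrite expr0 mul1r.
  rewrite !E0; split => //.
  by rewrite (_ : (fun r => - (r ^+ 0 * h1 r)) = fun r => - h1 r)//; apply/funext => r; rewrite mul1r.
have sn1 := supp_integrable_mul (cX n) s1.
have sn2 := supp_integrable_mul (cX n) s2.
have sS1 := supp_integrable_mul (cX n.+1) s1.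
have sS2 := supp_integrable_mul (cX n.+1) s2.
have E (h : R -> R) : (fun r => r * (r ^+ n * h r)) = (fun r => r ^+ n.+1 * h r).
  by apply/funext => r; rewrite mulrA -exprS.
split.
  have := band_null_derive sn2 (supp_integrableN sn1) IH2.
  have -> : (fun r => r * - (r ^+ n * h1 r)) = (fun r => - (r ^+ n.+1 * h1 r)).
    by apply/funext => r; rewrite mulrN mulrA -exprS.
  have -> : (fun r => - (r * (r ^+ n * h2 r))) = (fun r => - (r ^+ n.+1 * h2 r)).
    by apply/funext => r; rewrite mulrA -exprS.
  move/(band_nullN (supp_integrableN sS1) (supp_integrableN sS2)).
  by congr band_null; apply/funext => r; rewrite opprK.
have := band_null_derive sn1 sn2 IH1; rewrite !E.
by congr band_null; apply/funext => r; rewrite mulrA -exprS.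
Qed.

Lemma fourier_uniqueness (h1 h2 : R -> R) : supp_integrable h1 -> supp_integrable h2 ->
  band_null h1 h2 -> band_null h2 (fun r => - h1 r) ->
  {ae mu, forall r, h1 r = 0 /\ h2 r = 0}.
Proof.
move=> s1 s2 n1 n2; have sN1 := supp_integrableN s1.
pose k := (a + b) / 2.
have kab : a < k < b by apply/andP; split; move: ab; rewrite /k; lra.
pose m1 r := cos (k * r) * h1 r - sin (k * r) * h2 r.
pose m2 r := cos (k * r) * h2 r - sin (k * r) * - h1 r.
have [i1 z1] : supp_integrable m1 by exact: supp_integrable_wave.
have [i2 z2] : supp_integrable m2 by exact: supp_integrable_wave.
have M1 n : (\int[mu]_r (r ^+ n * m1 r) = 0)%R.
  have [/(_ k kab) <- _] := band_null_moment n s1 s2 n1 n2.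
  by apply: eq_Rintegral => r _; rewrite /m1; ring.
have M2 n : (\int[mu]_r (r ^+ n * m2 r) = 0)%R.
  have [_ /(_ k kab) <-] := band_null_moment n s1 s2 n1 n2.
  by apply: eq_Rintegral => r _; rewrite /m2; ring.
have := moments_eq0 L0 i2 z2 M2; have := moments_eq0 L0 i1 z1 M1.
apply: (@filterS2 _ _ (ae_filter_ringOfSetsType mu)) => r E1 E2.
(* The pair [(m1, m2)] is [(h1, h2)] rotated by the angle [k r]; the inverse rotation recovers [h1]
   and [h2]. *)
have cs : cos (k * r) ^+ 2 + sin (k * r) ^+ 2 = 1 by exact: cos2Dsin2.
have e1 : h1 r = cos (k * r) * m1 r + sin (k * r) * m2 r.
  rewrite -[LHS]mulr1 -cs /m1 /m2; ring.
have e2 : h2 r = cos (k * r) * m2 r - sin (k * r) * m1 r.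
  rewrite -[LHS]mulr1 -cs /m1 /m2; ring.
by split; [rewrite e1|rewrite e2]; rewrite E1 E2 !mulr0 ?addr0 ?subr0.
Qed.

End fourier_uniqueness.

(** * Radial densities *)

Section radial.
Context {R : realType}.
Local Notation mu := (@lebesgue_measure R).
Local Notation pos := (\1_(`]0%R, +oo[%classic) : R -> R).

(** The coordinates are nested as [(r, (th, ph))] so that integration in [mu \x leb2] has the
    angular integral of [sphere_integral] as its inner integral. *)
Definition sphere_point (x : pt3 R) (q : R * (R * R)) : pt3 R :=
  mkpt3 (x.1.1 + q.1 * sin q.2.1 * cos q.2.2) (x.1.2 + q.1 * sin q.2.1 * sin q.2.2)
        (x.2 + q.1 * cos q.2.1).

(* Jacobian [r^2 sin th] of the spherical coordinates [(r, (th, ph))], cut off to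
   their domain. *)
Definition sphere_jac (q : R * (R * R)) : R :=
  pos q.1 * q.1 ^+ 2 * (\1_(`[0, pi]) q.2.1 * sin q.2.1 * \1_(`[0, 2 * pi]) q.2.2).

Lemma dist3_sphere_point (x : pt3 R) (q : R * (R * R)) : 0 <= q.1 ->
  dist3 x (sphere_point x q) = q.1.
Proof.
move=> q0; rewrite /dist3 /sphere_point /mkpt3 /=.
have s1 : cos q.2.1 ^+ 2 = 1 - sin q.2.1 ^+ 2 by rewrite -(cos2Dsin2 q.2.1) addrK.
have s2 : cos q.2.2 ^+ 2 = 1 - sin q.2.2 ^+ 2 by rewrite -(cos2Dsin2 q.2.2) addrK.
rewrite (_ : _ + _ = q.1 ^+ 2); first by rewrite sqrtr_sqr ger0_norm.
rewrite !opprD !addrA !subrr !sub0r !sqrrN !exprMn s1 s2; ring.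
Qed.

Lemma sphere_jac_ge0 q : 0 <= sphere_jac q.
Proof.
apply: mulr_ge0; first by rewrite mulr_ge0// sqr_ge0.
apply: mulr_ge0 => //.
have [h|h] := boolP (0 <= q.2.1 <= pi); last by rewrite indic_itvE in_itv/= (negbTE h) mul0r.
by rewrite indic_itvE in_itv/= h mul1r sin_ge0_pi.
Qed.

Lemma sphere_jac_le0 q : q.1 <= 0 -> sphere_jac q = 0.
Proof. by move=> q0; rewrite /sphere_jac posF// !mul0r. Qed.

Lemma measurable_sphere_coords :
  [/\ measurable_fun setT (fun q : R * (R * R) => q.1),
      measurable_fun setT (fun q : R * (R * R) => q.2.1) &
      measurable_fun setT (fun q : R * (R * R) => q.2.2)].
Proof.
split; first exact: measurable_fst.
  exact: (measurableT_comp measurable_fst measurable_snd).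
exact: (measurableT_comp measurable_snd measurable_snd).
Qed.

Lemma measurable_sphere_point x : measurable_fun setT (sphere_point x).
Proof.
have [m1 m2 m3] := measurable_sphere_coords.
apply: measurable_fun_pair.
  apply: measurable_fun_pair; apply: measurable_funD => //; apply: measurable_funM.
  - by apply: measurable_funM => //; exact: (measurableT_comp measurable_sin m2).
  - exact: (measurableT_comp measurable_cos m3).
  - by apply: measurable_funM => //; exact: (measurableT_comp measurable_sin m2).
  - exact: (measurableT_comp measurable_sin m3).
apply: measurable_funD => //; apply: measurable_funM => //.
exact: (measurableT_comp measurable_cos m2).
Qed.

Lemma measurable_sphere_jac : measurable_fun setT sphere_jac.
Proof.
have [m1 m2 m3] := measurable_sphere_coords.
apply: measurable_funM.
  apply: measurable_funM; first exact: (measurableT_comp measurable_pos m1).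
  exact: measurable_funX.
apply: measurable_funM.
  apply: measurable_funM; last exact: (measurableT_comp measurable_sin m2).
  by apply: (measurableT_comp _ m2); exact: measurable_indic.
by apply: (measurableT_comp _ m3); exact: measurable_indic.
Qed.

Lemma measurable_dist3 (x : pt3 R) : measurable_fun setT (dist3 x).
Proof.
have m11 : measurable_fun setT (fun q : R * R * R => q.1.1) by
  exact: (measurableT_comp measurable_fst measurable_fst).
have m12 : measurable_fun setT (fun q : R * R * R => q.1.2) by
  exact: (measurableT_comp measurable_snd measurable_fst).
have m2 : measurable_fun setT (fun q : R * R * R => q.2) by exact: measurable_snd.
have ms : measurable_fun setT (@Num.sqrt R).
  by apply: continuous_measurable_fun; exact: sqrt_continuous.
apply: (measurableT_comp ms); apply: measurable_funD.
  by apply: measurable_funD; apply: measurable_funX; exact: measurable_funB.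
by apply: measurable_funX; exact: measurable_funB.
Qed.

Local Open Scope ereal_scope.

Lemma ge0_spherical (x : pt3 R) (G : pt3 R -> \bar R) :
  measurable_fun setT G -> (forall y, 0 <= G y) ->
  \int[leb3 R]_y G y =
  \int[(mu \x leb2 R)]_q ((sphere_jac q)%:E * G (sphere_point x q)).
Proof.
move=> mG G0.
pose W (q : R * (R * R)) : \bar R := (sphere_jac q)%:E * G (sphere_point x q).
have mW : measurable_fun setT W.
  apply: emeasurable_funM; first by apply/measurable_EFinP; exact: measurable_sphere_jac.
  exact: (measurableT_comp mG (measurable_sphere_point x)).
have W0 q : 0 <= W q by rewrite mule_ge0// lee_fin sphere_jac_ge0.
rewrite (spherical_coordinates x.1.1 x.1.2 x.2 mG G0).
transitivity (\int[mu]_r \int[leb2 R]_p W (r, p)); last first.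
  exact/esym/(@fubini_tonelli1 _ _ (measurableTypeR R) (measurableTypeR R * measurableTypeR R)%type R mu (leb2 R) W mW W0).
apply: eq_integral => r _.
have mWr : measurable_fun setT (fun p => W (r, p)) := measurable_fun_pair2 r mW.
exact/esym/(@fubini_tonelli1 _ _ (measurableTypeR R) (measurableTypeR R) R mu mu (fun p => W (r, p)) mWr).
Qed.

(** Positive and negative parts are treated separately. The Jacobian is nonnegative and therefore
    commutes with taking the maximum with 0. *)
Lemma spherical_integrable (x : pt3 R) (w : pt3 R -> R) :
  (leb3 R).-integrable setT (EFin \o w) ->
  (mu \x leb2 R).-integrable setT (fun q => (sphere_jac q * w (sphere_point x q))%:E) /\
  \int[leb3 R]_y (w y)%:E =
  \int[(mu \x leb2 R)]_q (sphere_jac q * w (sphere_point x q))%:E.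
Proof.
move=> iw; have /integrableP[mEw wfin] := iw.
have mw : measurable_fun setT w by exact/measurable_EFinP.
split.
  apply/integrableP; split.
    apply/measurable_EFinP; apply: measurable_funM; first exact: measurable_sphere_jac.
    exact: (measurableT_comp mw (measurable_sphere_point x)).
  rewrite (ge0_spherical x) in wfin => //; last exact: measurableT_comp.
  apply: le_lt_trans wfin; rewrite le_eqVlt; apply/orP; left; apply/eqP.
  by apply: eq_integral => q _; rewrite EFinM abseM /= ger0_norm// sphere_jac_ge0.
have P (v : pt3 R -> R) : measurable_fun setT v ->
  \int[leb3 R]_y (Num.max (v y) 0)%:E =
  \int[(mu \x leb2 R)]_q (Num.max (sphere_jac q * v (sphere_point x q)) 0)%:E.
  move=> mv; rewrite (ge0_spherical x); last 2 first.
  - by apply/measurable_EFinP; exact: measurable_maxr.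
  - by move=> y; rewrite lee_fin le_max lexx orbT.
  apply: eq_integral => q _; rewrite -EFinM; congr EFin.
  by rewrite maxr_pMr ?sphere_jac_ge0// mulr0.
rewrite integralE [RHS]integralE; congr (_ - _).
  transitivity (\int[leb3 R]_y (Num.max (w y) 0)%:E).
    by apply: eq_integral => y _; rewrite funeposE EFin_max.
  by rewrite P//; apply: eq_integral => q _; rewrite funeposE EFin_max.
transitivity (\int[leb3 R]_y (Num.max (- w y) 0)%:E).
  by apply: eq_integral => y _; rewrite funenegE EFin_max.
rewrite P//; last exact: measurableT_comp.
by apply: eq_integral => q _; rewrite funenegE EFin_max mulrN.
Qed.

End radial.

Section radial_density.
Context {R : realType}.
Local Notation mu := (@lebesgue_measure R).

Definition sphere_box : set (R * R) := [set p : R * R | 0 <= p.1 <= pi /\ 0 <= p.2 <= 2 * pi].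

Lemma sphere_jacE r p : 0 < r ->
  sphere_jac (r, p) = r ^+ 2 * (sin p.1 * \1_sphere_box p) :> R.
Proof.
move=> r0; rewrite /sphere_jac posT//= mul1r; congr (_ * _).
rewrite !indic_itvE !in_itv/= indicE.
have -> : (p \in sphere_box) = (0 <= p.1 <= pi) && (0 <= p.2 <= 2 * pi).
  by apply/idP/idP => [/set_mem[-> ->]//|/andP[? ?]]; exact/mem_set.
by case: (0 <= p.1 <= pi); case: (0 <= p.2 <= 2 * pi); rewrite ?mul0r ?mulr0 ?mul1r ?mulr1.
Qed.

(** By Fubini, [h r] is the angular integral of the Jacobian times [q / (4 pi r)]. A multiplier
    [phi] of the distance is constant on spheres and leaves that integral; it will be a cosine or a
    sine. The formula for [h] holds almost everywhere because only almost every spherical slice is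
    integrable. *)
Lemma radial_density (x : pt3 R) (d L : R) (q : pt3 R -> R) : 0 < d ->
  (leb3 R).-integrable setT (EFin \o q) ->
  (forall y, q y != 0 -> d <= dist3 x y <= L) ->
  exists h : R -> R, [/\ supp_integrable L h,
    {ae mu, forall r, 0 < r -> h r = (4 * pi * r)^-1 * (r ^+ 2 *
       \int[leb2 R]_(p in sphere_box) (q (sphere_point x (r, p)) * sin p.1))%R} &
    forall phi : R -> R, measurable_fun setT phi -> (forall r, `|phi r| <= 1) ->
      (leb3 R).-integrable setT
        (EFin \o (fun y => phi (dist3 x y) * ((4 * pi * dist3 x y)^-1 * q y))) /\
      (\int[leb3 R]_y (phi (dist3 x y) * ((4 * pi * dist3 x y)^-1 * q y)) =
       \int[mu]_r (phi r * h r))%R].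
Proof.
move=> d0 iq qs.
pose w (y : pt3 R) : R := (4 * pi * dist3 x y)^-1 * q y.
have mdist := measurable_dist3 x.
have iw : (leb3 R).-integrable setT (EFin \o w).
  apply: (@integrable_bounded_mul _ _ _ (leb3 R) ((4 * pi * d)^-1) (fun y => (4 * pi * dist3 x y)^-1)) => //.
    by apply: (measurableT_comp measurable_invr); exact: measurable_funM.
  move=> y /qs /andP[dy _]; have dy0 := lt_le_trans d0 dy.
  have p0 := pi_gt0 R.
  rewrite gtr0_norm ?invr_gt0 ?mulr_gt0//.
  by rewrite lef_pV2 ?posrE ?mulr_gt0// ler_pM2l// mulr_gt0.
pose K (z : R * (R * R)) : R := sphere_jac z * w (sphere_point x z).
have [iK _] := spherical_integrable x iw.
pose F (r : R) : \bar R := (\int[leb2 R]_p (K (r, p))%:E)%E.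
have iF : mu.-integrable setT F.
  exact: (@integrable_fubini_F _ _ (measurableTypeR R) (measurableTypeR R * measurableTypeR R)%type R mu (leb2 R) _ iK).
have aeK : {ae mu, forall r, (leb2 R).-integrable setT (fun p => (K (r, p))%:E)}.
  exact: (@ae_integrable1 _ _ (measurableTypeR R) (measurableTypeR R * measurableTypeR R)%type R mu (leb2 R) _ iK).
(* Where the slice integral is infinite [fine] returns 0, so [|h| <= |F|] holds everywhere. *)
pose h (r : R) : R := fine (F r).
have mh : measurable_fun setT h.
  by apply: measurableT_comp; [exact: fine_measurable|exact: measurable_int iF].
have ih : mu.-integrable setT (EFin \o h).
  apply: le_integrable iF => //; first exact/measurable_EFinP.
  by move=> r _; rewrite /= /h; case: (F r) => //=; rewrite normr0 leey.
have h0 r : (r <= 0) || (L < r) -> h r = 0.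
  move=> rL; rewrite /h /F integral0_eq// => p _; congr EFin; rewrite /K.
  have [r0|r0] := leP r 0; first by rewrite sphere_jac_le0// mul0r.
  have [qp|/qs /andP[_]] := eqVneq (q (sphere_point x (r, p))) 0; first by rewrite /w qp !mulr0.
  rewrite dist3_sphere_point ?(ltW r0)//= => rL'.
  by move: rL; rewrite leNgt r0/= ltNge rL'.
exists h; split.
- split => // r hr; apply: contraT; rewrite negb_and -!ltNge => rL.
  by move: hr; rewrite h0 ?eqxx//; case/orP: rL => [/ltW->//|->]; rewrite orbT.
- move: aeK; apply: (@filterS _ _ (ae_filter_ringOfSetsType mu)) => r iKr r0.
  have p0 := pi_gt0 R.
  pose C := (4 * pi * r)^-1 * r ^+ 2.
  have C0 : C != 0 by rewrite /C mulf_neq0 ?invr_eq0 ?expf_neq0 ?mulf_neq0 ?gt_eqF.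
  rewrite mulrA -/C Rintegral_mkcond.
  have E p : C * ((fun p => q (sphere_point x (r, p)) * sin p.1) \_ sphere_box) p = K (r, p).
    rewrite patchE /K sphere_jacE// /w dist3_sphere_point ?(ltW r0)//= indicE.
    by case: (p \in sphere_box); rewrite /C/= ?mulr1 ?mulr0 ?mul0r//; ring.
  rewrite -RintegralZl//; first by apply: eq_Rintegral => p _; rewrite E.
  (* Integrability of the unscaled angular integrand comes from that of the slice of [K] by dividing
     by [C]. *)
  have := integrableZl measurableT C^-1 iKr.
  by apply: eq_integrable => // p _; rewrite -EFinM -E /= mulKf.
move=> phi mphi phi1.
have iphiw : (leb3 R).-integrable setT (EFin \o (fun y => phi (dist3 x y) * w y)).
  apply: (@integrable_bounded_mul _ _ _ (leb3 R) 1 (fun y => phi (dist3 x y))) => //.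
  exact: (measurableT_comp mphi).
split; first exact: iphiw.
have [iK' E] := spherical_integrable x iphiw.
have KE z : sphere_jac z * (phi (dist3 x (sphere_point x z)) * w (sphere_point x z)) = phi z.1 * K z.
  have [z0|z0] := leP z.1 0; first by rewrite /K sphere_jac_le0// !(mul0r, mulr0).
  by rewrite dist3_sphere_point ?(ltW z0)// /K mulrCA.
have E' : (fun z => (sphere_jac z * (phi (dist3 x (sphere_point x z)) * w (sphere_point x z)))%:E) =
          (fun z => (phi z.1 * K z)%:E) by apply/funext => z; rewrite KE.
rewrite E' in iK'.
rewrite /Rintegral; congr fine; rewrite [LHS]E.
transitivity (\int[(mu \x leb2 R)%E]_z (phi z.1 * K z)%:E)%E.
  by apply: eq_integral => z _; rewrite KE.
transitivity (\int[mu]_r \int[leb2 R]_p (phi r * K (r, p))%:E)%E.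
  exact/esym/(@integral12_prod_meas1 _ _ (measurableTypeR R) (measurableTypeR R * measurableTypeR R)%type R mu (leb2 R) _ iK').
apply: ae_eq_integral => //.
- have := @integrable_fubini_F _ _ (measurableTypeR R) (measurableTypeR R * measurableTypeR R)%type R mu (leb2 R) _ iK'.
  exact: measurable_int.
- by apply/measurable_EFinP; exact: measurable_funM.
- move: aeK; apply: (@filterS _ _ (ae_filter_ringOfSetsType mu)) => r iKr _.
  under eq_integral do rewrite EFinM.
  rewrite integralZl// EFinM /h fineK//; exact: integrable_fin_num iKr.
Qed.

End radial_density.

(** * Distances from the observation point *)

Section geometry.
Context {R : realType}.
Implicit Types (x y : pt3 R) (D : set (pt3 R)).

Lemma sqr_dist3 x y :
  dist3 x y ^+ 2 = (x.1.1 - y.1.1) ^+ 2 + (x.1.2 - y.1.2) ^+ 2 + (x.2 - y.2) ^+ 2.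
Proof. by rewrite sqr_sqrtr// !addr_ge0// sqr_ge0. Qed.

Lemma dist3_ge0 x y : 0 <= dist3 x y.
Proof. exact: sqrtr_ge0. Qed.

Lemma dist3_coord x y : [/\ `|x.1.1 - y.1.1| <= dist3 x y, `|x.1.2 - y.1.2| <= dist3 x y &
  `|x.2 - y.2| <= dist3 x y].
Proof.
have s1 := sqr_ge0 (x.1.1 - y.1.1); have s2 := sqr_ge0 (x.1.2 - y.1.2).
have s3 := sqr_ge0 (x.2 - y.2).
by split; rewrite -[leLHS]sqrtr_sqr ler_wsqrtr//; lra.
Qed.

(** Some neighbourhood of [x] misses [D], which gives the lower bound; a finite union of bounded
    sets is bounded, which gives the upper one. *)
Lemma shell_bounds x D : admissible_D D -> ~ @closure (pt3 R) D x ->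
  exists d L : R, [/\ 0 < d, 0 < L & forall y, D y -> d <= dist3 x y <= L].
Proof.
move=> [M [Dm [M0 [dom [_ DE]]]]] nx.
have [B [B0 HB]] : exists B : R, 0 <= B /\ forall y, D y -> dist3 (mkpt3 0 0 0) y <= B.
  have /choice [b Hb] : forall m : 'I_M, exists B : R, forall y, Dm m y -> dist3 (mkpt3 0 0 0) y <= B.
    by move=> m; have [_ [_ [_ [B HB]]]] := dom m; exists B.
  exists (\sum_(m < M) `|b m|); split; first exact: sumr_ge0.
  move=> y; rewrite DE => -[m _ /Hb yb]; apply: le_trans yb _.
  by rewrite (bigD1 m)//= (le_trans (ler_norm _))// lerDl sumr_ge0.
have [e e0 He] : exists2 e : R, 0 < e & forall y, dist3 x y < e -> ~ D y.
  move: nx; rewrite /closure /= => /existsNP[V /not_implyP[nV VD]].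
  have [e /= e0 He] : nbhs_ball x V by rewrite nbhs_ballE.
  exists e => // y ye Dy; apply: VD; exists y; split => //; apply: He.
  have [c1 c2 c3] := dist3_coord x y.
  by split; [split|]; apply: le_lt_trans ye.
pose n2 : R := x.1.1 ^+ 2 + x.1.2 ^+ 2 + x.2 ^+ 2.
have n20 : 0 <= n2 by rewrite !addr_ge0// sqr_ge0.
(* The upper bound combines [t <= 1 + t^2] with [|x - y|^2 <= 2 |x|^2 + 2 |y|^2]; the latter follows
   from [|x + y|^2 >= 0] and replaces the triangle inequality. *)
exists e, (1 + 2 * n2 + 2 * B ^+ 2); split => //.
  by have := sqr_ge0 B; lra.
move=> y Dy; apply/andP; split; first by rewrite leNgt; apply/negP => /He.
have yB := HB _ Dy.
have yB2 : dist3 (mkpt3 0 0 0) y ^+ 2 <= B ^+ 2 by rewrite ler_pXn2r// nnegrE dist3_ge0.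
move: yB2; rewrite sqr_dist3 /= !sub0r !sqrrN => yB2.
have d2 := sqr_dist3 x y.
have h1 := sqr_ge0 (x.1.1 + y.1.1); have h2 := sqr_ge0 (x.1.2 + y.1.2).
have h3 := sqr_ge0 (x.2 + y.2); have h4 := sqr_ge0 (dist3 x y - 1).
move: (dist3 x y) d2 h4 yB2 h1 h2 h3 => t; rewrite /n2 !expr2 => d2 h4 yB2 h1 h2 h3.
have t0 := sqr_ge0 t.
nra.
Qed.

Lemma dist3_dilation x y (t : R) : 0 <= 1 + t ->
  dist3 x (mkpt3 (y.1.1 + t * (y.1.1 - x.1.1)) (y.1.2 + t * (y.1.2 - x.1.2))
    (y.2 + t * (y.2 - x.2))) = (1 + t) * dist3 x y.
Proof.
move=> t0; rewrite /dist3 /= -[X in _ = X * _](ger0_norm t0) -sqrtr_sqr -sqrtrM ?sqr_ge0//.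
congr Num.sqrt; ring.
Qed.

(** A point of an open component can be pushed slightly away from [x] along the ray through it
    without leaving the component. *)
Lemma admissible_not_sphere x D : admissible_D D -> ~ @closure (pt3 R) D x ->
  exists y z, [/\ D y, D z & dist3 x y < dist3 x z].
Proof.
move=> aD nx; have [d [L [d0 L0 sh]]] := shell_bounds aD nx.
move: aD => [M [Dm [M0 [dom [_ DE]]]]].
have [[y Dy] [oD _]] := dom (Ordinal M0).
have DmD z : Dm (Ordinal M0) z -> D z by rewrite DE => ?; exists (Ordinal M0).
have [e /= e0 He] : nbhs_ball y (Dm (Ordinal M0)).
  by rewrite nbhs_ballE; exact: open_nbhs_nbhs.
have /andP[yd yL] := sh _ (DmD _ Dy).
have dy0 : 0 < dist3 x y by exact: lt_le_trans yd.
(* The displacement then has length [t * dist3 x y = e / 2], inside the ball of radius [e]. *)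
pose t := e / (2 * dist3 x y).
have t0 : 0 < t by rewrite divr_gt0// mulr_gt0.
have tE : t * dist3 x y < e.
  have -> : t * dist3 x y = e / 2 by rewrite /t; field; rewrite gt_eqF.
  by rewrite ltr_pdivrMr// mulr_natr mulr2n ltrDl.
have [c1 c2 c3] := dist3_coord x y.
exists y, (mkpt3 (y.1.1 + t * (y.1.1 - x.1.1)) (y.1.2 + t * (y.1.2 - x.1.2))
    (y.2 + t * (y.2 - x.2))); split; first exact: DmD.
- apply/DmD/He.
  have step (u v : R) : `|v - u| <= dist3 x y -> `|u - (u + t * (u - v))| < e.
    move=> uv; rewrite opprD addrA subrr sub0r normrN normrM gtr0_norm// distrC.
    by apply: le_lt_trans tE; rewrite ler_wpM2l// ltW.
  by split; [split|]; apply: step.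
- by rewrite dist3_dilation ?ltr_pMl// ?ltrDl//; lra.
Qed.

End geometry.

(** * The radiated field as a Fourier transform *)

Section radiated_field_density.
Context {R : realType}.
Local Notation mu := (@lebesgue_measure R).

Lemma Rintegral_lin2 d (T : measurableType d) (m : {measure set T -> \bar R})
    (u v : T -> R) (s t : R) :
  m.-integrable setT (EFin \o u) -> m.-integrable setT (EFin \o v) ->
  m.-integrable setT (EFin \o (fun y => s * u y + t * v y)) /\
  (\int[m]_y (s * u y + t * v y) = s * \int[m]_y u y + t * \int[m]_y v y)%R.
Proof.
move=> iu iv.
have isu : m.-integrable setT (EFin \o (fun y => s * u y)) by exact: integrableZl iu.
have itv : m.-integrable setT (EFin \o (fun y => t * v y)) by exact: integrableZl iv.
split; first exact: (integrableD measurableT isu itv).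
by rewrite RintegralD// !RintegralZl.
Qed.

Lemma leb3_box_lty (I J K : set R) : measurable I -> measurable J -> measurable K ->
  (mu I < +oo)%E -> (mu J < +oo)%E -> (mu K < +oo)%E -> (leb3 R ((I `*` J) `*` K) < +oo)%E.
Proof.
move=> mI mJ mK fI fJ fK.
rewrite [X in (X < _)%E]product_measure1E//; last exact: measurableX.
rewrite [X in (X * _)%E]product_measure1E//.
by rewrite !lte_mul_pinfty// ?mule_ge0// ?ge0_fin_numE ?mule_ge0// lte_mul_pinfty// ge0_fin_numE.
Qed.

(* By [|u| <= 1 + u^2] on a box containing the support. *)
Lemma integrable_of_sqr (x : pt3 R) (L : R) (u : pt3 R -> R) :
  measurable_fun setT u -> (\int[leb3 R]_y (u y ^+ 2)%:E < +oo)%E ->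
  (forall y, u y != 0 -> dist3 x y <= L) ->
  (leb3 R).-integrable setT (EFin \o u).
Proof.
move=> mu_ u2 us.
pose box (c : R) : set R := `[c - L, c + L]%classic.
pose B : set (pt3 R) := (box x.1.1 `*` box x.1.2) `*` box x.2.
have mbox c : measurable (box c) by exact: measurable_itv.
have mB : measurable B := measurableX (measurableX (mbox _) (mbox _)) (mbox _).
have boxfin c : (mu (box c) < +oo)%E.
  rewrite [X in (X < _)%E]lebesgue_measure_itv; case: ifP => _ //=.
  by rewrite -EFinB ltry.
have Bfin : (leb3 R B < +oo)%E by apply: leb3_box_lty.
have i1 : (leb3 R).-integrable setT (EFin \o (\1_B : pt3 R -> R)).
  apply/integrableP; split; first by apply/measurable_EFinP; exact: measurable_indic.
  rewrite (_ : (\int[_]_y _)%E = leb3 R B)//.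
  transitivity (\int[leb3 R]_y (\1_B y)%:E)%E; last by rewrite integral_indic// setIT.
  by apply: eq_integral => y _; rewrite gee0_abs// lee_fin.
have i2 : (leb3 R).-integrable setT (fun y => (u y ^+ 2)%:E).
  apply/integrableP; split; first by apply/measurable_EFinP; exact: measurable_funX.
  apply: le_lt_trans u2; rewrite le_eqVlt; apply/orP; left; apply/eqP.
  by apply: eq_integral => y _; rewrite gee0_abs// lee_fin sqr_ge0.
apply: (le_integrable measurableT _ _ (integrableD measurableT i1 i2)).
  exact/measurable_EFinP.
move=> y _ /=; rewrite lee_fin.
have [->|uy] := eqVneq (u y) 0; first by rewrite normr0.
have [c1 c2 c3] := dist3_coord x y.
have dL := us y uy.
have inbox (c v : R) : `|c - v| <= dist3 x y -> box c v.
  move=> cv; have := le_trans cv dL; rewrite ler_norml => /andP[? ?].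
  by rewrite /box/= in_itv/=; apply/andP; split; lra.
have -> : \1_B y = 1 :> R.
  by rewrite indicE mem_set//; split; [split|]; apply: inbox.
rewrite [leRHS]ger0_norm ?addr_ge0 ?sqr_ge0//.
have h1 := sqr_ge0 (u y - 1); have h2 := sqr_ge0 (u y + 1).
by rewrite ler_norml; apply/andP; split; nra.
Qed.

Lemma L2_supported_integrable (D : set (pt3 R)) (x : pt3 R) (L : R) (f : pt3 R -> R[i]) :
  L2_supported_in D f -> (forall y, D y -> dist3 x y <= L) ->
  (leb3 R).-integrable setT (EFin \o (fun y => complex.Re (f y))) /\
  (leb3 R).-integrable setT (EFin \o (fun y => complex.Im (f y))).
Proof.
move=> [mr [mi [fin f0]]] DL.
have mr' : measurable_fun setT (fun y : pt3 R => complex.Re (f y)) := mr.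
have mi' : measurable_fun setT (fun y : pt3 R => complex.Im (f y)) := mi.
have supp y : f y != 0 -> dist3 x y <= L.
  by move=> fy; apply: DL; apply: contrapT => /f0 /eqP; exact/negP.
have bnd (u : pt3 R -> R) : measurable_fun setT u ->
    (forall y, u y ^+ 2 <= complex.Re (f y) ^+ 2 + complex.Im (f y) ^+ 2) ->
    (\int[leb3 R]_y (u y ^+ 2)%:E < +oo)%E.
  move=> mu_ le; apply: le_lt_trans fin; apply: ge0_le_integral => //.
  - by move=> y _; rewrite lee_fin sqr_ge0.
  - by apply/measurable_EFinP; exact: measurable_funX.
  - by apply/measurable_EFinP; apply: measurable_funD; exact: measurable_funX.
  - by move=> y _; rewrite lee_fin.
split; apply: (@integrable_of_sqr x L) => //.
- by apply: bnd => // y; rewrite lerDl sqr_ge0.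
- by move=> y fy; apply: supp; apply: contraNneq fy => ->.
- by apply: bnd => // y; rewrite lerDr sqr_ge0.
- by move=> y fy; apply: supp; apply: contraNneq fy => ->.
Qed.

(** The densities [h1] and [h2] belong to the real and imaginary parts of [f]. The imaginary
    integral is written with [- h1] so as to be the integral of [band_null h2 (- h1)] verbatim. *)
Lemma radiated_field_density (D : set (pt3 R)) (x : pt3 R) (d L : R) (f : pt3 R -> R[i]) :
  0 < d -> L2_supported_in D f -> (forall y, D y -> d <= dist3 x y <= L) ->
  exists h1 h2 : R -> R, [/\ supp_integrable L h1, supp_integrable L h2,
    {ae mu, forall r, 0 < r -> ftilde f x r = Complex (h1 r) (h2 r)} &
    forall (g : R -> R[i]) k, radiated_field D f g x k =
      Complex (\int[mu]_r (cos (k * r) * h1 r - sin (k * r) * h2 r))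
              (\int[mu]_r (cos (k * r) * h2 r - sin (k * r) * - h1 r)) * g k].
Proof.
move=> d0 Lf sh.
have [i1 i2] := L2_supported_integrable Lf (fun y Dy => proj2 (andP (sh y Dy))).
have f0 : forall y, ~ D y -> f y = 0 by have [_ [_ []]] := Lf.
have supp y : f y != 0 -> d <= dist3 x y <= L.
  by move=> fy; apply: sh; apply: contrapT => /f0 /eqP; exact/negP.
have suppRe y : complex.Re (f y) != 0 -> d <= dist3 x y <= L.
  by move=> fy; apply: supp; apply: contraNneq fy => ->.
have suppIm y : complex.Im (f y) != 0 -> d <= dist3 x y <= L.
  by move=> fy; apply: supp; apply: contraNneq fy => ->.
have [h1 [s1 ae1 int1]] := radial_density d0 i1 suppRe.
have [h2 [s2 ae2 int2]] := radial_density d0 i2 suppIm.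
exists h1, h2; split => //.
  move: ae1 ae2; apply: (@filterS2 _ _ (ae_filter_ringOfSetsType mu)) => r E1 E2 r0.
  rewrite /ftilde r0 /sphere_integral /cintegral E1// E2//.
  rewrite (_ : (\int[leb2 R]_(p in sphere_box) _)%R = (\int[leb2 R]_(p in
     [set p : R * R | (0 <= p.1 <= pi)%R /\ (0 <= p.2 <= 2 * pi)%R])
       complex.Re (f (sphere_point x (r, p)) * rc (sin p.1)))%R); last first.
    by apply: eq_Rintegral => p _; case: (f _) => u v /=; ring.
  rewrite (_ : (\int[leb2 R]_(p in sphere_box) _)%R = (\int[leb2 R]_(p in
     [set p : R * R | (0 <= p.1 <= pi)%R /\ (0 <= p.2 <= 2 * pi)%R])
       complex.Im (f (sphere_point x (r, p)) * rc (sin p.1)))%R); last first.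
    by apply: eq_Rintegral => p _; case: (f _) => u v /=; ring.
  apply/eqP; rewrite eq_complex /=; apply/andP; split; apply/eqP; rewrite !(mul0r, mulr0, subr0, addr0, add0r)//.
move=> g k.
have mC : measurable_fun setT (fun r : R => cos (k * r)).
  by apply: (measurableT_comp measurable_cos); exact: measurable_funM.
have mS : measurable_fun setT (fun r : R => sin (k * r)).
  by apply: (measurableT_comp measurable_sin); exact: measurable_funM.
have bC r : `|cos (k * r)| <= 1 by rewrite ler_norml cos_geN1 cos_le1.
have bS r : `|sin (k * r)| <= 1 by rewrite ler_norml sin_geN1 sin_le1.
have [ic1 Ec1] := int1 _ mC bC; have [is1 Es1] := int1 _ mS bS.
have [ic2 Ec2] := int2 _ mC bC; have [is2 Es2] := int2 _ mS bS.
(* These are the real and imaginary parts of the product of [e^{ikr}] with the density; the next two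
   lines multiply by [g k]. *)
have [iA EA] := Rintegral_lin2 1 (-1) ic1 is2.
have [iB EB] := Rintegral_lin2 1 1 ic2 is1.
have [_ ER] := Rintegral_lin2 (complex.Re (g k)) (- complex.Im (g k)) iA iB.
have [_ EI] := Rintegral_lin2 (complex.Im (g k)) (complex.Re (g k)) iA iB.
have ib (phi h : R -> R) : measurable_fun setT phi -> (forall r, `|phi r| <= 1) ->
    supp_integrable L h -> mu.-integrable setT (EFin \o (fun r => phi r * h r)).
  by move=> mphi bphi [ih _]; apply: (@integrable_bounded_mul _ _ _ mu 1 phi) => // r _.
have -> : (\int[mu]_r (cos (k * r) * h1 r - sin (k * r) * h2 r))%R =
    (\int[mu]_r (cos (k * r) * h1 r) - \int[mu]_r (sin (k * r) * h2 r))%R.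
  by rewrite RintegralB//; exact: ib.
have -> : (\int[mu]_r (cos (k * r) * h2 r - sin (k * r) * - h1 r))%R =
    (\int[mu]_r (cos (k * r) * h2 r) + \int[mu]_r (sin (k * r) * h1 r))%R.
  rewrite -RintegralD//; [|exact: ib|exact: ib].
  by apply: eq_Rintegral => r _; rewrite mulrN opprK.
rewrite /radiated_field /cintegral.
have out y : ~ D y -> Phi x y k * (f y * g k) = 0 by move=> /f0 ->; rewrite mul0r mulr0.
have EX (P : R[i] -> R) : P 0 = 0 ->
    (\int[leb3 R]_(y in D) P (Phi x y k * (f y * g k)) = \int[leb3 R]_y P (Phi x y k * (f y * g k)))%R.
  move=> P0; rewrite Rintegral_mkcond; apply: eq_Rintegral => y _; rewrite patchE; case: ifPn => // /negP yD.
  by rewrite out ?P0// => Dy; apply: yD; exact/mem_set.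
rewrite (EX (fun z => complex.Re z))// (EX (fun z => complex.Im z))//.
apply/eqP; rewrite eq_complex /=; apply/andP; split; apply/eqP.
- transitivity (complex.Re (g k) * (1 * \int[mu]_r (cos (k * r) * h1 r) + -1 * \int[mu]_r (sin (k * r) * h2 r)) +
     - complex.Im (g k) * (1 * \int[mu]_r (cos (k * r) * h2 r) + 1 * \int[mu]_r (sin (k * r) * h1 r)))%R; last first.
    by case: (g k) => p q /=; ring.
  rewrite -Ec1 -Es1 -Ec2 -Es2 -EA -EB -ER; apply: eq_Rintegral => y _.
  by rewrite /Phi /rc; case: (g k) => p q; case: (f y) => u v /=; ring.
- transitivity (complex.Im (g k) * (1 * \int[mu]_r (cos (k * r) * h1 r) + -1 * \int[mu]_r (sin (k * r) * h2 r)) +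
     complex.Re (g k) * (1 * \int[mu]_r (cos (k * r) * h2 r) + 1 * \int[mu]_r (sin (k * r) * h1 r)))%R; last first.
    by case: (g k) => p q /=; ring.
  rewrite -Ec1 -Es1 -Ec2 -Es2 -EA -EB -EI; apply: eq_Rintegral => y _.
  by rewrite /Phi /rc; case: (g k) => p q; case: (f y) => u v /=; ring.
Qed.

End radiated_field_density.

(** * Identification of the annulus *)

Section annulus_identification.
Context {R : realType}.
Local Notation mu := (@lebesgue_measure R).
Implicit Types (x y : pt3 R) (D : set (pt3 R)).

Lemma ftilde_eq0_off_shell D f x (d L r : R) :
  L2_supported_in D f -> (forall y, D y -> d <= dist3 x y <= L) -> 0 < r ->
  ~~ (d <= r <= L) -> ftilde f x r = 0.
Proof.
move=> [_ [_ [_ f0]]] sh r0 rout.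
have fz p : f (sphere_point x (r, p)) = 0.
  apply: f0 => /sh; rewrite dist3_sphere_point/= ?(ltW r0)//; exact/negP.
rewrite /ftilde r0 /sphere_integral /cintegral.
have Z (P : R[i] -> R) (B : set (R * R)) : P 0 = 0 ->
    (\int[leb2 R]_(p in B) P (f (sphere_point x (r, p)) * rc (sin p.1)) = 0)%R.
  move=> P0; rewrite /Rintegral integral0_eq// => p _.
  by rewrite fz mul0r P0.
rewrite (Z (fun z => complex.Re z))// (Z (fun z => complex.Im z))//.
by rewrite (_ : Complex 0 0 = 0 :> R[i])// !mulr0.
Qed.

Lemma not_negligible_itv (N : set R) (a b : R) : a < b -> mu.-negligible N ->
  exists2 r, a < r <= b & ~ N r.
Proof.
move=> ab [A [mA A0 NA]]; apply: contrapT => H.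
have sub : `]a, b]%classic `<=` A.
  move=> r /=; rewrite in_itv/= => rab; apply: NA; apply: contrapT => nr.
  by apply: H; exists r.
have : (mu `]a, b]%classic <= mu A)%E by apply: le_measure; rewrite ?inE.
rewrite A0 leNgt => /negP; apply.
by rewrite [X in (_ < X)%E]lebesgue_measure_itv/= lte_fin ab -EFinB lte_fin subr_gt0.
Qed.

(** If two endpoints differed, some interval of positive length would lie in one of the segments and
    outside the other, and it would contain a point off [N]. *)
Lemma itv_eq_of_ae (N : set R) (m M m' M' : R) : mu.-negligible N -> m < M -> m' < M' ->
  (forall r, ~ N r -> (m <= r <= M) = (m' <= r <= M')) -> m = m' /\ M = M'.
Proof.
have low (N0 : set R) (u U v V : R) : mu.-negligible N0 -> u < U ->
    (forall r, ~ N0 r -> (u <= r <= U) -> (v <= r <= V)) -> v <= u /\ U <= V.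
  move=> N00 uU uv; split; rewrite leNgt; apply/negP => h.
    (* The radius found may equal the right end of the interval; the midpoint keeps it strictly
       below [v]. *)
    have uw : u < Num.min ((u + v) / 2) U by rewrite lt_min uU andbT; lra.
    have [r /andP[ur]] := not_negligible_itv uw N00.
    rewrite le_min => /andP[rv rU] /uv; rewrite (ltW ur) rU => /(_ isT) /andP[vr _].
    by lra.
  have wU : Num.max u V < U by rewrite gt_max uU h.
  have [r /andP[]] := not_negligible_itv wU N00.
  rewrite gt_max => /andP[ur Vr] rU /uv; rewrite (ltW ur) rU => /(_ isT) /andP[_ rV].
  by move: Vr; rewrite ltNge rV.
move=> N0 mM mM' E.
have [h1 h2] := low N m M m' M' N0 mM (fun r nr h => etrans (esym (E r nr)) h).
have [h3 h4] := low N m' M' m M N0 mM' (fun r nr h => etrans (E r nr) h).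
by split; apply/eqP; rewrite eq_le ?h1 ?h2 ?h3 ?h4.
Qed.

Lemma dist3_image_bounds D x : admissible_D D -> ~ @closure (pt3 R) D x ->
  let S := (fun z => dist3 x z) @` D in
  [/\ 0 < inf S, inf S < sup S & forall y, D y -> inf S <= dist3 x y <= sup S].
Proof.
move=> aD nx S; have [d [L [d0 L0 sh]]] := shell_bounds aD nx.
have [y [z [Dy Dz yz]]] := admissible_not_sphere aD nx.
(* Real [inf] and [sup] are meaningful only for nonempty sets bounded on the relevant side. *)
have lS : has_lbound S by exists d => _ [w Dw <-]; have /andP[] := sh w Dw.
have uS : has_ubound S by exists L => _ [w Dw <-]; have /andP[] := sh w Dw.
have bd w : D w -> inf S <= dist3 x w <= sup S.
  by move=> Dw; apply/andP; split; [apply: ge_inf|apply: ub_le_sup] => //; exists w.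
split => //.
  apply: lt_le_trans d0 _; apply: lb_le_inf; first by exists (dist3 x y), y.
  by move=> _ [w Dw <-]; have /andP[] := sh w Dw.
have /andP[h1 _] := bd y Dy; have /andP[_ h2] := bd z Dz.
exact: le_lt_trans h1 (lt_le_trans yz h2).
Qed.

End annulus_identification.

Theorem theorem2p1 (R : realType) (kmax a b : R) (g : R -> R[i])
    (x : pt3 R) (D D' : set (pt3 R)) (f f' : pt3 R -> R[i]) :
  0 < kmax ->
  0 <= a -> a < b -> b <= kmax ->
  {within [set k : R | 0 < k < kmax], continuous (fun k => complex.Re (g k))} ->
  {within [set k : R | 0 < k < kmax], continuous (fun k => complex.Im (g k))} ->
  (forall k, a < k < b -> g k != 0) ->
  admissible_D D -> admissible_D D' ->
  L2_supported_in D f -> L2_supported_in D' f' ->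
  ~ @closure (pt3 R) D x -> ~ @closure (pt3 R) D' x ->
  (@lebesgue_measure R).-negligible (zero_radii D f x) ->
  (@lebesgue_measure R).-negligible (zero_radii D' f' x) ->
  (forall k, a < k < b -> radiated_field D f g x k = radiated_field D' f' g x k) ->
  annular_hull D x = annular_hull D' x.
Proof.
move=> _ _ ab _ _ _ g0 aD aD' Lf Lf' nx nx' N1 N2 uu'.
have [d [L [d0 L0 sh]]] := shell_bounds aD nx.
have [d' [L' [d0' L0' sh']]] := shell_bounds aD' nx'.
have [h1 [h2 [s1 s2 ft fld]]] := radiated_field_density d0 Lf sh.
have [h1' [h2' [s1' s2' ft' fld']]] := radiated_field_density d0' Lf' sh'.
pose T := Num.max L L'.
have T0 : 0 < T by rewrite lt_max L0.
have widen (l : R) (h : R -> R) : l <= T -> supp_integrable l h -> supp_integrable T h.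
  move=> lT [ih sh_]; split => // r /sh_ /andP[-> rl]; exact: le_trans rl lT.
have LT : L <= T by rewrite le_max lexx.
have LT' : L' <= T by rewrite le_max lexx orbT.
have {}s1 := widen _ _ LT s1; have {}s2 := widen _ _ LT s2.
have {}s1' := widen _ _ LT' s1'; have {}s2' := widen _ _ LT' s2'.
pose k1 r := h1 r - h1' r; pose k2 r := h2 r - h2' r.
have sk1 : supp_integrable T k1 by apply: supp_integrableD => //; exact: supp_integrableN.
have sk2 : supp_integrable T k2 by apply: supp_integrableD => //; exact: supp_integrableN.
have cmp k : a < k < b ->
    (\int[@lebesgue_measure R]_r (cos (k * r) * h1 r - sin (k * r) * h2 r) =
     \int[@lebesgue_measure R]_r (cos (k * r) * h1' r - sin (k * r) * h2' r))%R /\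
    (\int[@lebesgue_measure R]_r (cos (k * r) * h2 r - sin (k * r) * - h1 r) =
     \int[@lebesgue_measure R]_r (cos (k * r) * h2' r - sin (k * r) * - h1' r))%R.
  (* The nonzero factor [g k] cancels, and equality of complex numbers splits into the two real
     equalities. *)
  move=> kab; have := uu' k kab; rewrite fld fld' => /(mulIf (g0 k kab)).
  by move=> [-> ->].
have n1 : band_null a b k1 k2.
  move=> k kab; have [E _] := cmp k kab.
  rewrite (_ : (\int[_]_r _)%R = \int[@lebesgue_measure R]_r
    ((cos (k * r) * h1 r - sin (k * r) * h2 r) - (cos (k * r) * h1' r - sin (k * r) * h2' r)))%R.
    by rewrite RintegralB// ?E ?subrr//; [exact: (supp_integrable_wave T0 k s1 s2).1|exact: (supp_integrable_wave T0 k s1' s2').1].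
  by apply: eq_Rintegral => r _; rewrite /k1 /k2; ring.
have n2 : band_null a b k2 (fun r => - k1 r).
  move=> k kab; have [_ E] := cmp k kab.
  have sN := supp_integrableN T0 s1; have sN' := supp_integrableN T0 s1'.
  rewrite (_ : (\int[_]_r _)%R = \int[@lebesgue_measure R]_r
    ((cos (k * r) * h2 r - sin (k * r) * - h1 r) - (cos (k * r) * h2' r - sin (k * r) * - h1' r)))%R.
    by rewrite RintegralB// ?E ?subrr//; [exact: (supp_integrable_wave T0 k s2 sN).1|exact: (supp_integrable_wave T0 k s2' sN').1].
  by apply: eq_Rintegral => r _; rewrite /k1 /k2; ring.
have kz := fourier_uniqueness T0 ab sk1 sk2 n1 n2.
have feq : {ae @lebesgue_measure R, forall r, 0 < r -> ftilde f x r = ftilde f' x r}.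
  move: ft ft' kz.
  apply: (@filterS3 _ _ (ae_filter_ringOfSetsType (@lebesgue_measure R))) => r E1 E2 [K1 K2] r0.
  rewrite E1// E2//; congr Complex; apply/eqP; rewrite -subr_eq0; exact/eqP.
pose N := zero_radii D f x `|` zero_radii D' f' x `|`
  ~` [set r | 0 < r -> ftilde f x r = ftilde f' x r].
have N0 : (@lebesgue_measure R).-negligible N.
  by apply: negligibleU => //; exact: negligibleU.
have [m0 mM bd] := dist3_image_bounds aD nx.
have [m0' mM' bd'] := dist3_image_bounds aD' nx'.
(* Off the exceptional radii, lying between [inf] and [sup] is the same as [ftilde] being nonzero, a
   condition that both sources share. A sphere with such a radius is in the hull because the hull is
   defined by distance alone. *)
have key (E : set (pt3 R)) (h : pt3 R -> R[i]) (r : R) :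
    let S := (fun z => dist3 x z) @` E in
    0 < inf S -> L2_supported_in E h -> (forall y, E y -> inf S <= dist3 x y <= sup S) ->
    ~ zero_radii E h x r -> 0 < r -> (inf S <= r <= sup S) = (ftilde h x r != 0).
  move=> S mS LE bE nz r0; apply/idP/idP => [rS|].
    apply/eqP => ft0; apply: nz; split => //; split => // y yr.
    by rewrite /annular_hull /= yr.
  by apply: contraNT => rS; rewrite (ftilde_eq0_off_shell LE bE r0 rS).
have [Em EM] : inf ((fun z => dist3 x z) @` D) = inf ((fun z => dist3 x z) @` D') /\
    sup ((fun z => dist3 x z) @` D) = sup ((fun z => dist3 x z) @` D').
  apply: (itv_eq_of_ae N0 mM mM') => r nr.
  have [r0|r0] := ltP 0 r; last first.
    (* A radius [r <= 0] belongs to neither segment, as both infima are positive. *)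
    rewrite [in LHS]leNgt [in RHS]leNgt (le_lt_trans r0 m0) (le_lt_trans r0 m0')//.
  rewrite (key D f r)// ?(key D' f' r)//.
  - have -> // : ftilde f x r = ftilde f' x r.
    by apply: contrapT => H; apply: nr; right => /(_ r0).
  - by move=> z; apply: nr; left; right.
  - by move=> z; apply: nr; left; left.
by rewrite /annular_hull Em EM.
Qed.
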